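(* The class of $p$-shifted distributions on $S_\infty$, as $p$ runs over all probability distributions $\{p_j\}_{j=1}^\infty$ on $\mathbb{N}=\{1,2,\dots\}$ whose supports are all of $\mathbb{N}$ (i.e. $p_j>0$ for all $j$) and that satisfy $\sum_{n=1}^\infty np_n<\infty$, coincides with the class of probability distributions $P$ on $S_\infty$ that satisfy the following three conditions: (i) the backward ranks $\{I_{<j}\}_{j=2}^\infty$ are independent under $P$; (ii) a random permutation under $P$ is strictly regenerative with a positive recurrent renewal mechanism, and the probability $u_1=P(\Pi([1])=[1])$ of renewal at the number $1$ is positive; (iii) for all $n\in\mathbb{N}$, the support of $P_n(\cdot):=P\big(\mathrm{proj}_n^{-1}(\cdot)\big)$ is all of $S_n$.
   Context: $S_n$ is the set of permutations of $[n]=\{1,\dots,n\}$, and $S_\infty$ is the set of permutations $\sigma=\sigma_1\sigma_2\cdots$ of $\mathbb{N}$. $p$-shifted distributions: for a probability distribution $p=\{p_j\}_{j=1}^\infty$ on $\mathbb{N}$ with $p_j>0$ for all $j$, take i.i.d. samples $n_1,n_2,\dots$ from $p$. Define the random permutation $\Pi\in S_\infty$ by $\Pi_1=n_1$ and, for $k\ge2$, $\Pi_k=\psi_k(n_k)$, where $\psi_k$ is the increasing bijection from $\mathbb{N}$ to $\mathbb{N}-\{\Pi_1,\dots,\Pi_{k-1}\}$. The law of $\Pi$ on $S_\infty$ is the $p$-shifted distribution. Projection: for $\sigma\in S_\infty$, $\mathrm{proj}_n(\sigma)\in S_n$ is obtained from $\sigma=\sigma_1\sigma_2\cdots$ by deleting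 every $\sigma_i$ with $\sigma_i>n$. Backward ranks: for $j\ge2$, $I_{<j}(\sigma)$ is the number of $i<j$ such that the number $i$ appears to the right of the number $j$ in $\sigma=\sigma_1\sigma_2\cdots$, i.e. $I_{<j}(\sigma)=|\{i<j:\sigma^{-1}_i>\sigma^{-1}_j\}|$. Strictly regenerative: for a permutation $\pi=\pi_{a+1}\pi_{a+2}\cdots\pi_{a+m}$ of $\{a+1,\dots,a+m\}$, the reduced permutation $\mathrm{red}(\pi)\in S_m$ is given by $\mathrm{red}(\pi)_i=\pi_{a+i}-a$. A random permutation $\Pi$ of $S_\infty$ is strictly regenerative if almost surely there exist $0=T_0<T_1<T_2<\cdots$ such that $\Pi([T_j])=[T_j]$ for $j\ge1$ and $\Pi([m])\ne[m]$ if $m\notin\{T_1,T_2,\dots\}$, and such that the random variables $\{T_k-T_{k-1}\}_{k=1}^\infty$ are IID and the random permutations $\{\mathrm{red}(\Pi|_{[T_k]-[T_{k-1}]})\}_{k=1}^\infty$ are IID. The numbers $T_j$ are called renewal numbers. The renewal mechanism is positive recurrent if $T_1$ has finite expectation. *)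

(* Defs.v *)
From HB Require Import structures.
From mathcomp Require Import all_boot all_order all_algebra all_fingroup.
From mathcomp Require Import finmap.
From mathcomp Require Import all_classical all_reals all_analysis.

Set Implicit Arguments.
Unset Strict Implicit.
Unset Printing Implicit Defensive.

Import Order.TTheory GRing.Theory Num.Theory.

Local Open Scope classical_set_scope.

(* Convention: N = {1, 2, ...} is encoded by [nat] through n |-> n - 1, for
   positions as well as for letters, so that [m] = {1, ..., m} is ['I_m] as a
   type and [`I_m] as a subset of [nat], and the letter (or position) n of the
   mathematics is the element n.-1 here.  Cardinalities, renewal numbers and
   the index n of S_n are true natural numbers and are not shifted. *)

Record permN := PermN {
  permN_fun :> nat -> nat ;
  permN_bij : bijective permN_fun }.

HB.instance Definition _ := gen_eqMixin permN.
HB.instance Definition _ := gen_choiceMixin permN.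
HB.instance Definition _ := isPointed.Build permN
  (@PermN id (Bijective (frefl id) (frefl id))).

(* The sigma-algebra of S_infinity is the one generated by the coordinates. *)
Definition permN_cylinders : set (set permN) :=
  [set A | exists i j : nat, A = [set s : permN | s i = j]].

HB.instance Definition _ :=
  @isMeasurable.Build (sigma_display permN_cylinders) permN
    <<s permN_cylinders >> (@sigma_algebra0 _ setT permN_cylinders)
    (@sigma_algebraC _ permN_cylinders)
    (@sigma_algebra_bigcup _ setT permN_cylinders).

Lemma permN_surj (s : permN) v : exists i, s i == v.
Proof. by case: (permN_bij s) => g _ gK; exists (g v); rewrite gK. Qed.

(* s^-1(v), the position of the letter v *)
Definition pos (s : permN) (v : nat) : nat := ex_minn (permN_surj s v).

Lemma pos_can (s : permN) : cancel (pos s) s.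
Proof. by move=> v; rewrite /pos; case: ex_minnP => i /eqP. Qed.

Lemma permN_inj (s : permN) : injective s.
Proof. exact: bij_inj (permN_bij s). Qed.

(* A prefix of s long enough to contain all letters of [n], from which the
   letters outside [n] are deleted. *)
Definition proj_word (n : nat) (s : permN) : seq 'I_n :=
  pmap insub [seq s i | i <- iota 0 (\max_(v < n) (pos s v).+1)].

Lemma proj_word_uniq n s : uniq (proj_word n s).
Proof.
by rewrite pmap_sub_uniq// map_inj_uniq ?iota_uniq//; exact: permN_inj.
Qed.

Lemma mem_proj_word n s v : v \in proj_word n s.
Proof.
rewrite mem_pmap_sub; apply/mapP; exists (pos s v); last by rewrite pos_can.
by rewrite mem_iota add0n (leq_bigmax (F := fun v : 'I_n => (pos s v).+1)).
Qed.

Lemma size_proj_word n s : size (proj_word n s) = n.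
Proof.
rewrite -(card_uniqP (proj_word_uniq n s)) -[RHS]card_ord.
by apply: eq_card => v; rewrite mem_proj_word.
Qed.

Lemma proj_word_inj n s : injective (fun i : 'I_n => nth i (proj_word n s) i).
Proof.
move=> i j; rewrite (set_nth_default i j) ?size_proj_word// => /eqP.
by rewrite nth_uniq ?size_proj_word ?proj_word_uniq// => /eqP/val_inj.
Qed.

Definition proj_perm (n : nat) (s : permN) : 'S_n := perm (@proj_word_inj n s).

(* Since letters are shifted by one, the rank I_{<j} is
   [backward_rank s j.-1]. *)
Definition backward_rank (j : nat) (s : permN) : nat :=
  #|[pred i : 'I_j | pos s j < pos s i]|.

Definition renews (s : permN) (m : nat) : Prop := s @` `I_m = `I_m.

(* One-line notation of red(s|_{[b]-[a]}).  It is an element of S_{b-a} when s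
   renews at a and at b; permutations of all (random) sizes live in the
   discrete space [seq nat], the size of the word being the size of the
   permutation. *)
Definition red_block (s : permN) (a b : nat) : seq nat :=
  [seq s (a + i) - a | i <- iota 0 (b - a)].

HB.instance Definition _ := isPointed.Build (seq nat) [::].
HB.instance Definition _ := @isMeasurable.Build default_measure_display
  (seq nat) discrete_measurable discrete_measurable0
  discrete_measurableC discrete_measurableU.

Section probability_notions.
Local Open Scope ereal_scope.
Context {R : realType}.

Definition independent_seq {d d'} {T : measurableType d}
    {T' : measurableType d'} (P : probability T R) (X : nat -> T -> T') : Prop :=
  forall (J : {fset nat}) (A : nat -> set T'), (forall i, measurable (A i)) ->
    P (\bigcap_(i in [set` J]) (X i @^-1` A i)) =
    \prod_(i <- J) P (X i @^-1` A i).

Definition iid {d d'} {T : measurableType d} {T' : measurableType d'}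
    (P : probability T R) (X : nat -> T -> T') : Prop :=
  independent_seq P X /\
  forall i j (A : set T'), measurable A -> P (X i @^-1` A) = P (X j @^-1` A).

(* w = w_0 w_1 ... is built from the samples x: w_k = psi_k(x_k), where psi_k is
   the increasing bijection onto the complement of {w_0, ..., w_(k-1)}.  For
   k = 0 this forces psi_0 = id and w_0 = x_0. *)
Definition shifted (x w : nat -> nat) : Prop :=
  forall k, exists psi : nat -> nat,
    [/\ {homo psi : a b / (a < b)%N}, range psi = ~` (w @` `I_k)
      & w k = psi (x k)].

(* P is the law of a random permutation Pi built from i.i.d. samples of p.  The
   construction exhausts N only almost surely, whence the "almost surely". *)
Definition shifted_law (p : probability nat R) (P : probability permN R) : Prop :=
  exists (d : measure_display) (Omega : measurableType d)
    (Pr : probability Omega R) (X : nat -> {RV Pr >-> nat})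
    (Pi : {RV Pr >-> permN}),
  [/\ independent_seq Pr (fun k => X k : Omega -> nat),
      forall k (A : set nat), measurable A -> distribution Pr (X k) A = p A,
      {ae Pr, forall o, shifted (fun k => X k o) (Pi o)}
    & forall A : set permN, measurable A -> distribution Pr Pi A = P A].

Definition strictly_regenerative (P : probability permN R)
    (T : nat -> {RV P >-> nat}) : Prop :=
  [/\ {ae P, forall s,
        [/\ T 0%N s = 0%N, forall k, (T k s < T k.+1 s)%N,
            forall j, (0 < j)%N -> renews s (T j s)
          & forall m, (0 < m)%N -> (forall j, (0 < j)%N -> m <> T j s) ->
              ~ renews s m]},
      iid P (fun k s => T k.+1 s - T k s)%N
    & iid P (fun k s => red_block s (T k s) (T k.+1 s))].

Definition positive_recurrent (P : probability permN R)
    (T : nat -> {RV P >-> nat}) : Prop :=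
  'E_P[fun s => (T 1%N s)%:R%R] < +oo.

Definition proj_support (P : probability permN R) (n : nat) : set 'S_n :=
  [set t | 0 < P (proj_perm n @^-1` [set t])].

End probability_notions.

Arguments proj_support {R} P n.
Arguments strictly_regenerative {R} P T.
Arguments positive_recurrent {R} P T.

(* Main.v *)
(** Let [code s k] be the number of letters smaller than [s k] that occur after
    position [k], and [b_j] the backward rank of [j]; then [b_(s k) = code s k],
    so codes and backward ranks are the same inversion counts, listed by position
    and by letter.  [P] is [p]-shifted iff the codes are i.i.d. of law [p].

    If they are, P(s|[m] = t) is the product of the [p (code t k)] when [t] is a
    permutation of [m], that is, of the [p (b_j t)]; hence, given a renewal at
    [m], the backward ranks are independent and [b_j] has the law [p] conditioned
    on [0, j], and [u_m] is the product of the [p[0, j]] for j < m.  After a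
    renewal the codes start afresh, so decomposing along the last renewal before
    [m] gives 1 = sum_(j <= m) u_j P(T_1 > m - j).  The [u_m] are bounded below iff
    [p] has a finite mean, and then E T_1 <= 1 / inf u; removing the conditioning
    on a renewal is an inversion of the renewal equation.

    Conversely, let Q_j = P(b_j < j).  A renewal at 1 says b_j < j for all j >= 1,
    and regeneration at 1 gives P(b_(j+1) = i | b_(j+1) <= j) = P(b_j = i).  Thus
    P(b_j = i) is proportional to weights p_i that do not depend on j, and u_1 > 0
    says exactly that the weights are summable.  The law of the projections then
    gives that of the codes in the limit, and E T_1 < oo forces inf u > 0 in the
    identity above. *)

Require Import Defs.
From HB Require Import structures.
From mathcomp Require Import all_boot all_order all_algebra all_fingroup.
From mathcomp Require Import finmap.
From mathcomp Require Import all_classical all_reals all_analysis.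
From mathcomp Require Import measurable_realfun zify ring lra.

Set Implicit Arguments.
Unset Strict Implicit.
Unset Printing Implicit Defensive.

Import Order.TTheory GRing.Theory Num.Theory.
Import numFieldNormedType.Exports.

Local Open Scope classical_set_scope.
Local Open Scope nat_scope.

(** * Codes of permutations *)

(** The codes are read off prefixes, but a backward rank is not: whether one letter lies to the
    right of another is known only once one of them has occurred, arbitrarily late. A renewal at m
    closes off the letters of [m] and makes both descriptions finite, which is why backward ranks
    are first treated jointly with a renewal. If an event A on the first n letters satisfies P(A and
    renewal at m) = c u_m for all m >= n, then the first renewal from n on splits both sides into
    convolutions with u; as u_0 = 1 the system is triangular and can be cancelled term by term, so
    P(A) = c once renewals occur almost surely. They do: P(T_1 > n) is nonincreasing in n with sum
    at most 1 / inf u, hence is O(1/n), and the same rate holds after any fixed time. The mean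
    enters because the factors of u_m are 1 minus the tails of p, and these tails are summable
    exactly when the mean is finite. Shifts and next renewals are total functions with junk values,
    and events are replaced by ones that depend on finitely many letters, so that measurability and
    regeneration reduce to finite sums. *)

Definition code (s : permN) (k : nat) : nat :=
  count (fun v => k < pos s v) (iota 0 (s k)).

Lemma pos_perm (s : permN) : cancel s (pos s).
Proof. by move=> i; apply: (@permN_inj s); rewrite pos_can. Qed.

Lemma mem_prefix (s : permN) k v : (v \in map s (iota 0 k)) = (pos s v < k).
Proof.
rewrite -[in LHS](pos_can s v) (mem_map (@permN_inj s)).
by rewrite mem_iota add0n.
Qed.

Lemma card_count_iota n (Q : pred nat) :
  #|[pred i : 'I_n | Q i]| = count Q (iota 0 n).
Proof.
rewrite -val_enum_ord count_map -sum1_count big_mkcond big_enum -big_mkcond /=.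
by rewrite sum1_card; apply: eq_card.
Qed.

Lemma backward_rank_code (s : permN) k : backward_rank (s k) s = code s k.
Proof. by rewrite /backward_rank pos_perm (card_count_iota _ (fun i => k < pos s i)). Qed.

Lemma backward_rank_pos (s : permN) j : backward_rank j s = code s (pos s j).
Proof. by rewrite -backward_rank_code pos_can. Qed.

(** Unlike [pos s], the prefix [map s (iota 0 k)] only involves [s] below [k]. *)
Lemma codeE (s : permN) k :
  code s k = count (fun v => v \notin map s (iota 0 k)) (iota 0 (s k)).
Proof.
apply: eq_in_count => v; rewrite mem_iota add0n /= => lt_v.
rewrite mem_prefix -leqNgt [RHS]leq_eqVlt.
by case: (k =P pos s v) => // e; move: lt_v; rewrite e pos_can ltnn.
Qed.

Lemma count_iota_ltn (Q : pred nat) x y :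
  x < y -> Q x -> count Q (iota 0 x) < count Q (iota 0 y).
Proof.
move=> xy Qx; rewrite -(subnKC xy) iotaD -[x.+1]addn1 iotaD !count_cat /= add0n Qx; lia.
Qed.

Lemma code_inj (s s' : permN) n : (forall k, k < n -> code s k = code s' k) ->
  forall k, k < n -> s k = s' k.
Proof.
move=> ecode; elim/ltn_ind => k IHk lt_kn.
have eprefix : map s (iota 0 k) = map s' (iota 0 k).
  apply/eq_in_map => i; rewrite mem_iota add0n /= => lt_ik.
  by apply: IHk => //; apply: ltn_trans lt_kn.
move: (ecode k lt_kn); rewrite !codeE eprefix => e.
have [lt|lt|//] := ltngtP (s k) (s' k); exfalso.
- have := @count_iota_ltn (fun v => v \notin map s' (iota 0 k)) _ _ lt.
  by rewrite e ltnn -eprefix mem_prefix pos_perm ltnn; move/(_ isT).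
- have := @count_iota_ltn (fun v => v \notin map s' (iota 0 k)) _ _ lt.
  by rewrite e ltnn mem_prefix pos_perm ltnn; move/(_ isT).
Qed.

Lemma eq_code (s s' : permN) n : (forall k, k < n -> s k = s' k) ->
  forall k, k < n -> code s k = code s' k.
Proof.
move=> es k lt_kn; rewrite !codeE es//; congr count; apply/funext => v.
congr (v \notin _); apply/eq_in_map => i; rewrite mem_iota add0n /= => lt_ik.
by apply: es; apply: ltn_trans lt_kn.
Qed.

(** By counting, an injection of [m] into itself is onto. This form involves only the first m
    letters. *)
Lemma renewsP (s : permN) m : renews s m <-> (forall i, i < m -> s i < m).
Proof.
split=> [R i im|R].
  have : (s @` `I_m) (s i) by exists i.
  by rewrite R.
apply/seteqP; split=> [v [i /= im <-]|v /= vm]; first exact: R.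
have : v \in map s (iota 0 m).
  have e : map s (iota 0 m) =i iota 0 m.
    apply: (uniq_min_size _ _ _).2.
    - by rewrite map_inj_uniq ?iota_uniq//; exact: permN_inj.
    - move=> x /mapP[i]; rewrite !mem_iota !add0n /= => im ->; exact: R.
    - by rewrite size_map.
  by rewrite e mem_iota add0n.
by case/mapP=> i; rewrite mem_iota add0n /= => im ->; exists i.
Qed.

Lemma renews_pos (s : permN) m : renews s m -> forall v, (pos s v < m) = (v < m).
Proof.
move=> R v; apply/idP/idP=> [|vm].
  by move/(proj1 (renewsP s m) R); rewrite pos_can.
have : (s @` `I_m) v by rewrite R.
by case=> i /= im <-; rewrite pos_perm.
Qed.

Lemma renews_ge (s : permN) m : renews s m -> forall i, m <= i -> m <= s i.
Proof. by move=> R i mi; rewrite leqNgt -(renews_pos R) pos_perm -leqNgt. Qed.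

Lemma eq_renews (s s' : permN) n m : m <= n ->
  (forall k, k < n -> s k = s' k) -> renews s m -> renews s' m.
Proof.
move=> mn es /renewsP R; apply/renewsP => i im.
by rewrite -es ?R//; apply: leq_trans mn.
Qed.

Lemma eq_pos_renews (s s' : permN) n : (forall k, k < n -> s k = s' k) ->
  renews s n -> forall v, v < n -> pos s v = pos s' v.
Proof.
move=> es R v vn; apply: (@permN_inj s'); rewrite pos_can -es ?pos_can//.
by rewrite (renews_pos R).
Qed.

Lemma eq_backward_rank (s s' : permN) j : (forall v, v <= j -> pos s v = pos s' v) ->
  backward_rank j s = backward_rank j s'.
Proof.
move=> e; apply: eq_card => i; rewrite !inE !e//; exact: ltnW.
Qed.

Lemma renews0 s : renews s 0.
Proof. by apply/renewsP. Qed.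

Lemma shiftp_bij (s : permN) m : renews s m ->
  bijective (fun i => s (m + i) - m).
Proof.
move=> R; exists (fun v => pos s (m + v) - m) => i.
  by rewrite subnKC ?pos_perm ?addKn//; apply: (renews_ge R); apply: leq_addr.
rewrite subnKC ?pos_can ?addKn//.
by rewrite leqNgt (renews_pos R) -leqNgt leq_addr.
Qed.

(** Junk value: [point] when [s] does not renew at [m]. *)
Definition shiftp (m : nat) (s : permN) : permN :=
  if pselect (renews s m) is left R then PermN (shiftp_bij R) else point.

Lemma shiftpE (m : nat) (s : permN) i : renews s m -> shiftp m s i = s (m + i) - m.
Proof. by rewrite /shiftp => R; case: pselect. Qed.

Lemma shiftpK (m : nat) (s : permN) i : renews s m -> s (m + i) = m + shiftp m s i.
Proof. by move=> R; rewrite shiftpE// subnKC// (renews_ge R)// leq_addr. Qed.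

Lemma shiftp_pos (m : nat) (s : permN) v : renews s m ->
  pos s (m + v) = m + pos (shiftp m s) v.
Proof.
by move=> R; apply: (@permN_inj s); rewrite pos_can shiftpK// pos_can.
Qed.

Lemma shiftp_renews (m : nat) (s : permN) i : renews s m ->
  renews (shiftp m s) i <-> renews s (m + i).
Proof.
move=> R; rewrite !renewsP; split=> H k lt.
  have [km|mk] := ltnP k m; first by have := proj1 (renewsP _ _) R k km; lia.
  by rewrite -(subnKC mk) shiftpK// ltn_add2l H//; lia.
by rewrite -(ltn_add2l m) -shiftpK// H// ltn_add2l.
Qed.

(** The letters below m all occur before position m, so they never contribute to a code taken from m
    on; the other letters are merely translated. *)
Lemma shiftp_code (m : nat) (s : permN) k : renews s m ->
  code (shiftp m s) k = code s (m + k).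
Proof.
move=> R; rewrite /code shiftpK// iotaD count_cat.
rewrite (_ : count _ (iota 0 m) = 0) ?add0n; last first.
  apply/eqP; rewrite -leqn0 leqNgt -has_count; apply/hasPn => v.
  rewrite mem_iota add0n /= => vm; rewrite -leqNgt.
  by move: (vm); rewrite -(renews_pos R) => /ltnW; lia.
have -> x : iota m x = map (addn m) (iota 0 x) by rewrite -iotaDl addn0.
rewrite count_map; apply: eq_count => v /=.
by rewrite shiftp_pos// ltn_add2l.
Qed.

Lemma shiftp_red_block (m : nat) (s : permN) a b : renews s m ->
  red_block (shiftp m s) a b = red_block s (m + a) (m + b).
Proof.
move=> R; rewrite /red_block subnDl; apply: eq_map => i.
by rewrite -addnA (shiftpK _ R) subnDl.
Qed.

(** Exactly m - k letters of [m] stand at positions from k on, and [s k] is one of them that its own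
    code does not count. *)
Lemma renews_code_lt (s : permN) m k : renews s m -> k < m -> code s k < m - k.
Proof.
move=> R km.
have Rk := proj1 (renewsP _ _) R.
have cm : count (fun v => k <= pos s v) (iota 0 m) = m - k.
  have e : perm_eq (iota 0 m) (map s (iota 0 m)).
    apply: uniq_perm; rewrite ?map_inj_uniq ?iota_uniq//; first exact: permN_inj.
    by move=> v; rewrite mem_iota add0n mem_prefix (renews_pos R).
  rewrite (seq.permP e) count_map (eq_count (a2 := leq k)); last first.
    by move=> i /=; rewrite pos_perm.
  rewrite -[X in iota _ X](subnKC (ltnW km)) iotaD count_cat add0n.
  rewrite (_ : count _ (iota 0 k) = 0) ?add0n; last first.
    apply/eqP; rewrite -leqn0 leqNgt -has_count; apply/hasPn => v.
    by rewrite mem_iota add0n /= -ltnNge.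
  rewrite (eq_in_count (a2 := predT)) ?count_predT ?size_iota// => v.
  by rewrite mem_iota => /andP[].
rewrite -cm.
apply: leq_ltn_trans (@count_iota_ltn (fun v => k <= pos s v) (s k) m _ _).
- by apply: sub_count => v /= /ltnW.
- exact: Rk.
- by rewrite pos_perm.
Qed.

(** * Finite permutations *)

Section Extension.
Variable n : nat.
Implicit Types (t : 'S_n).

(** Extending by the identity lets elements of ['S_n] borrow positions, codes and backward ranks
    from [permN]. *)
Definition ext_fun t (v : nat) : nat :=
  if insub v is Some i then val (t i) else v.

Lemma ext_funE t (i : 'I_n) : ext_fun t i = t i.
Proof. by rewrite /ext_fun valK. Qed.

Lemma ext_fun_can t : cancel (ext_fun t) (ext_fun t^-1).
Proof.
move=> v; rewrite [in ext_fun t v]/ext_fun; case: insubP => [i _ <-|nv].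
  by rewrite ext_funE permK.
by rewrite /ext_fun insubN.
Qed.

Lemma ext_fun_bij t : bijective (ext_fun t).
Proof.
exists (ext_fun t^-1); first exact: ext_fun_can.
by have := ext_fun_can t^-1; rewrite invgK.
Qed.

Definition ext t : permN := PermN (ext_fun_bij t).

Lemma extE t (i : 'I_n) : ext t i = t i.
Proof. exact: ext_funE. Qed.

Lemma pos_ext t (i : 'I_n) : pos (ext t) i = (t^-1)%g i.
Proof. by apply: (@permN_inj (ext t)); rewrite pos_can extE permKV. Qed.

Lemma renews_ext t : renews (ext t) n.
Proof. by apply/renewsP => i lt_in; rewrite (extE t (Ordinal lt_in)). Qed.

Lemma ext_inj t t' : (forall i, i < n -> ext t i = ext t' i) -> t = t'.
Proof. by move=> e; apply/permP => i; apply: val_inj; rewrite /= -!extE e. Qed.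

Lemma code_ext t (k : 'I_n) :
  code (ext t) k = #|[pred i : 'I_n | (k < i) && (t i < t k)]|.
Proof.
rewrite /code extE -sum1_card.
transitivity (\sum_(v < n | (k < (t^-1)%g v) && (v < t k)) 1); last first.
  by rewrite (reindex_inj (@perm_inj _ t)); apply: eq_bigl => i; rewrite inE permK.
rewrite sum1_card.
transitivity (count (fun v => (k < pos (ext t) v) && (v < t k)) (iota 0 n)).
  have -> : iota 0 n = iota 0 (t k) ++ iota (t k) (n - t k).
    by rewrite -[X in _ ++ iota X _]add0n -iotaD subnKC ?(ltnW (ltn_ord _)).
  rewrite count_cat.
  rewrite [X in _ + X](_ : _ = 0) ?addn0; last first.
    apply/eqP; rewrite -leqn0 leqNgt -has_count; apply/hasPn => v.
    by rewrite mem_iota => /andP[/leq_gtF ->]; rewrite andbF.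
  by apply: eq_in_count => v; rewrite mem_iota add0n => /= ->; rewrite andbT.
by rewrite -card_count_iota; apply: eq_card => v; rewrite !unfold_in /= pos_ext.
Qed.

Lemma backward_rank_ext t (j : 'I_n) :
  backward_rank j (ext t) =
  #|[pred v : 'I_n | (v < j) && ((t^-1)%g j < (t^-1)%g v)]|.
Proof.
rewrite -[in LHS](permKV t j) -extE backward_rank_code code_ext -!sum1_card.
rewrite (reindex_inj (@perm_inj _ (t^-1)%g)); apply: eq_bigl => i.
by rewrite !inE !permKV andbC.
Qed.

(** Inversion exchanges positions and letters, and the two reversals restore the direction of the
    inequalities. This involution turns statements about codes into statements about backward
    ranks. *)
Definition revp t : 'S_n :=
  (perm (@rev_ord_inj n) * t^-1 * perm (@rev_ord_inj n))%g.

Lemma revpE t i : revp t i = rev_ord ((t^-1)%g (rev_ord i)).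
Proof. by rewrite /revp !permM !permE. Qed.

Lemma revpVE t i : ((revp t)^-1)%g i = rev_ord (t (rev_ord i)).
Proof.
by apply: (@perm_inj _ (revp t)); rewrite permKV revpE rev_ordK permK rev_ordK.
Qed.

Lemma revpK : involutive revp.
Proof. by move=> t; apply/permP => i; rewrite revpE revpVE !rev_ordK. Qed.

Lemma code_revp t (j : 'I_n) :
  code (ext (revp t)) (rev_ord j) = backward_rank j (ext t).
Proof.
rewrite code_ext backward_rank_ext -!sum1_card (reindex_inj (@rev_ord_inj n)).
apply: eq_bigl => i; rewrite !inE !revpE !rev_ordK /=.
by have := ltn_ord i; have := ltn_ord j; have := ltn_ord (t^-1%g i);
  have := ltn_ord (t^-1%g j); lia.
Qed.

Lemma ext_code_inj t t' :
  (forall k : 'I_n, code (ext t) k = code (ext t') k) -> t = t'.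
Proof.
move=> e; apply: ext_inj; apply: code_inj => k lt_kn.
exact: (e (Ordinal lt_kn)).
Qed.

Lemma ext_backward_rank_inj t t' :
  (forall j : 'I_n, backward_rank j (ext t) = backward_rank j (ext t')) -> t = t'.
Proof.
move=> e; apply: (can_inj revpK); apply: ext_code_inj => k.
by rewrite -[k]rev_ordK !code_revp.
Qed.

Lemma code_ext_lt t (k : 'I_n) : code (ext t) k < n - k.
Proof. by apply: renews_code_lt => //; exact: renews_ext. Qed.

Lemma prod_code_backward_rank (R : comPzRingType) (g : nat -> R) t :
  (\prod_(k < n) g (code (ext t) k) = \prod_(j < n) g (backward_rank j (ext t)))%R.
Proof.
rewrite [RHS](reindex_inj (@perm_inj _ t)); apply: eq_bigr => k _.
by rewrite -extE backward_rank_code.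
Qed.

(** The Lehmer code. The sharper bound n - k on the k-th entry is left to [code_ffun_image], so that
    the codomain does not depend on k. *)
Definition code_ffun t : {ffun 'I_n -> 'I_n} :=
  [ffun k => Ordinal (leq_trans (code_ext_lt t k) (leq_subr _ _))].

Lemma code_ffun_inj : injective code_ffun.
Proof.
move=> t t' /ffunP e; apply: ext_code_inj => k.
by have := e k; rewrite !ffunE => /(congr1 val).
Qed.

Lemma card_lt_ord m : m <= n -> #|[pred i : 'I_n | i < m]| = m.
Proof.
move=> mn; rewrite (card_count_iota n (fun i => i < m)) -(subnKC mn) iotaD.
rewrite count_cat add0n (eq_in_count (a2 := predT)); last first.
  by move=> i; rewrite mem_iota.
rewrite count_predT size_iota [X in _ + X](_ : _ = 0) ?addn0//.
apply/eqP; rewrite -leqn0 leqNgt -has_count; apply/hasPn => v.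
by rewrite mem_iota -leqNgt => /andP[].
Qed.

(** The code is injective and its entries obey the bounds; the number of functions obeying them is
    the product of the n - k, that is n!, so all are attained. *)
Lemma code_ffun_image :
  code_ffun @: [set: 'S_n]%SET =
  [set f in family (fun k : 'I_n => [pred i : 'I_n | i < n - k])].
Proof.
apply/eqP; rewrite eqEcard; apply/andP; split.
  apply/fintype.subsetP => f /imsetP[t _ ->]; rewrite inE; apply/familyP => k.
  by rewrite ffunE inE /= code_ext_lt.
rewrite card_imset; last exact: code_ffun_inj.
rewrite cardsT cardsE card_family card_Sn fact_prod.
rewrite (big_addn 0 n.+1 1) subn1 /= big_mkord foldrE big_map big_enum /=.
rewrite (reindex_inj (@rev_ord_inj n)) /=; apply/eq_leq/eq_bigr => k _.
by rewrite card_lt_ord ?leq_subr//; have := ltn_ord k; lia.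
Qed.

(** As a permutation is a free choice of code entries, the sum over permutations distributes into a
    product. All normalising constants come from here. *)
Lemma sum_prod_code (R : comNzRingType) (g : nat -> nat -> R) :
  (\sum_(t : 'S_n) \prod_(k < n) g k (code (ext t) k) =
   \prod_(k < n) \sum_(i < n - k) g k i)%R.
Proof.
under [RHS]eq_bigr => k _ do
  rewrite (big_ord_widen n (fun i => g k i) (leq_subr k n)).
apply/esym; transitivity
    (\sum_(f in code_ffun @: [set: 'S_n]%SET) \prod_(k < n) g k (f k))%R.
  rewrite (bigA_distr_big_dep (fun k i : 'I_n => i < n - k)
    (fun k i : 'I_n => g k i)).
  apply: eq_bigl => f.
  by rewrite code_ffun_image; set A := finset _; rewrite finset.in_set.
rewrite big_imset /=; last by move=> t t' _ _; apply: code_ffun_inj.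
apply: eq_big => [t|t _]; first by rewrite !inE.
apply: eq_bigr => k _.
by rewrite ffunE.
Qed.

Lemma sum_prod_backward_rank (R : comNzRingType) (g : nat -> nat -> R) :
  (\sum_(t : 'S_n) \prod_(j < n) g j (backward_rank j (ext t)) =
   \prod_(j < n) \sum_(i < j.+1) g j i)%R.
Proof.
have := sum_prod_code (fun k i => g (n - k.+1) i).
rewrite (reindex_inj (can_inj revpK)) (reindex_inj (@rev_ord_inj n)) => /= e.
transitivity (\sum_(t : 'S_n) \prod_(k < n)
    g (n - k.+1)%N (code (ext (revp t)) k))%R.
  apply: eq_bigr => t _; rewrite [RHS](reindex_inj (@rev_ord_inj n)).
  apply: eq_bigr => j _; rewrite code_revp /=; congr g.
  by have := ltn_ord j; lia.
rewrite e; apply: eq_bigr => j _ /=.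
rewrite (_ : n - (n - j.+1) = j.+1); last by have := ltn_ord j; lia.
apply: eq_bigr => i _; congr g; have := ltn_ord j; lia.
Qed.

End Extension.

Lemma val_proj_word n (s : permN) : map val (proj_word n s) =
  [seq v <- map s (iota 0 (\max_(v < n) (pos s v).+1)) | v < n].
Proof.
rewrite /proj_word (pmap_filter (insubK _)).
by apply: eq_filter => v; rewrite isSome_insub.
Qed.

Lemma proj_permE n (s : permN) (i : 'I_n) :
  proj_perm n s i = nth 0 (map val (proj_word n s)) i :> nat.
Proof.
by rewrite permE /= (nth_map i) ?size_proj_word.
Qed.

Lemma proj_perm_ltn n (s : permN) (i j : 'I_n) : i < j ->
  pos s (proj_perm n s i) < pos s (proj_perm n s j).
Proof.
move=> ij; rewrite !proj_permE.
set W := map val _.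
have sW : size W = n by rewrite size_map size_proj_word.
(* Deleting letters keeps the others in order of position. *)
have srt : sorted ltn (map (pos s) W).
  rewrite /W val_proj_word filter_map -map_comp map_id_in; last first.
    by move=> k _; rewrite /= pos_perm.
  by apply: sorted_filter; [exact: ltn_trans | exact: iota_ltn_sorted].
rewrite -(nth_map 0 0 (pos s)) ?sW// -(nth_map 0 0 (pos s)) ?sW//.
apply: (sorted_ltn_nth ltn_trans 0 srt) => //; rewrite inE size_map sW; exact: ltn_ord.
Qed.

Lemma proj_perm_pos n (s : permN) (u v : 'I_n) :
  (pos s u < pos s v) = (pos (ext (proj_perm n s)) u < pos (ext (proj_perm n s)) v).
Proof.
rewrite !pos_ext; set t := proj_perm n s.
have E (w : 'I_n) : pos s w = pos s (t (t^-1 w)%g) by rewrite permKV.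
rewrite (E u) (E v) {}/E.
have [lt|lt|e] := ltngtP (val (t^-1 u)%g) (val (t^-1 v)%g).
- by rewrite proj_perm_ltn.
- by apply/negbTE; rewrite -leqNgt ltnW// proj_perm_ltn.
- by rewrite (val_inj e) ltnn.
Qed.

Lemma backward_rank_proj n (s : permN) j : j < n ->
  backward_rank j (ext (proj_perm n s)) = backward_rank j s.
Proof.
move=> jn; apply: eq_card => i; rewrite !inE.
have := proj_perm_pos s (Ordinal jn) (Ordinal (ltn_trans (ltn_ord i) jn)).
by move=> /= ->.
Qed.

(** The backward ranks of the first n letters determine their relative order. Events about
    projections thus become product events in the ranks. *)
Lemma proj_perm_eq n (s : permN) (t : 'S_n) :
  proj_perm n s = t <-> forall j, j < n -> backward_rank j s = backward_rank j (ext t).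
Proof.
split=> [<- j jn|e]; first by rewrite backward_rank_proj.
by apply: ext_backward_rank_inj => j; rewrite backward_rank_proj// e.
Qed.

(** No letter is deleted among the first k. This recovers a prefix of [s], and so its codes, from a
    large enough projection. *)
Lemma proj_perm_prefix n (s : permN) k : (forall i, i < k -> s i < n) ->
  forall i, i < k -> ext (proj_perm n s) i = s i.
Proof.
move=> H i ik.
have kM : k <= \max_(v < n) (pos s v).+1.
  case: k H ik => // k H _.
  have sk := H k (ltnSn k).
  apply: leq_trans (leq_bigmax (F := fun v : 'I_n => (pos s v).+1) (Ordinal sk)).
  by rewrite /= pos_perm.
have W : map val (proj_word n s) = map s (iota 0 k) ++
    [seq v <- map s (iota k (\max_(v < n) (pos s v).+1 - k)) | v < n].
  rewrite val_proj_word -{1}(subnKC kM) iotaD map_cat filter_cat add0n.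
  congr (_ ++ _); apply/all_filterP/allP => v /mapP[l].
  by rewrite mem_iota add0n /= => lk ->; exact: H.
have kn : k <= n.
  by rewrite -(size_proj_word n s) -(size_map val) W size_cat size_map size_iota leq_addr.
rewrite (extE _ (Ordinal (leq_trans ik kn))) proj_permE W nth_cat.
by rewrite size_map size_iota ik (nth_map 0) ?size_iota// nth_iota.
Qed.

Lemma renews_proj_perm n (s : permN) : renews s n ->
  forall i, i < n -> s i = ext (proj_perm n s) i.
Proof. by move=> /renewsP R i lt_in; rewrite (proj_perm_prefix R). Qed.

(** * Measurability and laws of countably valued maps *)

Section CountableValues.
Context d (T : measurableType d).

Lemma measurable_preimage_count (T' : countType) (X : T -> T') :
  (forall a, measurable (X @^-1` [set a])) ->
  forall A : set T', measurable (X @^-1` A).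
Proof.
move=> mX A.
have -> : X @^-1` A = \bigcup_(n in [set n | exists a, choice.unpickle n = Some a /\ A a])
    (if choice.unpickle n is Some a then X @^-1` [set a] else set0).
  apply/seteqP; split=> [t /= At|t [n /= [a [-> Aa]] /= ->//]].
  by exists (choice.pickle (X t)); rewrite /= choice.pickleK//; exists (X t).
by apply: bigcup_measurable => n [a [-> _]]; exact: mX.
Qed.

Lemma measurable_prefix (T' : countType) (X : nat -> T -> T') n :
  (forall i a, measurable (X i @^-1` [set a])) ->
  forall w, measurable ((fun t => [seq X i t | i <- iota 0 n]) @^-1` [set w]).
Proof.
move=> mX w; have [sw|sw] := eqVneq (size w) n; last first.
  rewrite (_ : _ @^-1` _ = set0)//; apply/seteqP; split=> // t /= e.
  by move: sw; rewrite -e size_map size_iota eqxx.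
rewrite (_ : _ @^-1` _ =
    \bigcap_(i in `I_n) (X i @^-1` [set b | forall a0, nth a0 w i = b])).
  apply: fin_bigcap_measurable; first exact: finite_II.
  by move=> i _; exact: measurable_preimage_count.
apply/seteqP; split=> [t /= <- i /= ni a0|t /= H].
  by rewrite (nth_map 0) ?size_iota// nth_iota.
(* The default of [nth] must come from [T'], which may be empty; then [T] is empty as well, or n =
   0. *)
have [a0|w0] := pselect (exists a0 : T', True).
  case: a0 => a0 _; apply: (@eq_from_nth _ a0); rewrite size_map size_iota// => i ni.
  by rewrite (nth_map 0) ?size_iota// nth_iota// (H i ni a0).
case: n sw H => [/size0nil -> //|n _ _].
by exfalso; apply: w0; exists (X 0 t).
Qed.

(** The values of [X] are countable, so [A] is a countable union of cylinders. *)
Lemma measurable_finite_dep (T' : countType) (X : nat -> T -> T') n (A : set T) :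
  (forall i a, measurable (X i @^-1` [set a])) ->
  (forall t t', (forall i, i < n -> X i t = X i t') -> A t -> A t') ->
  measurable A.
Proof.
move=> mX HA.
have -> : A = (fun t => [seq X i t | i <- iota 0 n]) @^-1`
              ((fun t => [seq X i t | i <- iota 0 n]) @` A).
  apply/seteqP; split=> [t At|t [t' At' /eq_in_map e]]; first by exists t.
  by apply: HA At' => i ni; apply: e; rewrite mem_iota.
exact/measurable_preimage_count/measurable_prefix.
Qed.

End CountableValues.

(** The events of the sigma-algebra of the first n letters, in a form that is checked pointwise and
    needs no separate measurability proof. *)
Definition local (n : nat) (A : set permN) :=
  forall s s' : permN, (forall i, i < n -> s i = s' i) -> A s -> A s'.

Lemma local_renews m n : m <= n -> local n [set s | renews s m].
Proof. by move=> mn s s' e; apply: eq_renews mn e. Qed.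

Lemma measurable_letter i j : measurable [set s : permN | s i = j].
Proof. by apply: sub_sigma_algebra; exists i, j. Qed.

Lemma measurable_local n (A : set permN) : local n A -> measurable A.
Proof.
move=> lA; apply: (@measurable_finite_dep _ permN nat (fun i s => s i) n) => //.
exact: measurable_letter.
Qed.

Lemma measurable_pos v k : measurable [set s : permN | pos s v = k].
Proof.
rewrite (_ : [set _ | _] = [set s : permN | s k = v]).
  exact: measurable_letter.
by apply/seteqP; split=> s /= <-; rewrite ?pos_can ?pos_perm.
Qed.

Lemma measurable_renews m : measurable [set s : permN | renews s m].
Proof. exact: measurable_local (local_renews (leqnn m)). Qed.

Lemma measurable_code k (A : set nat) : measurable [set s : permN | A (code s k)].
Proof.
by apply: (@measurable_local k.+1) => s s' e /=; rewrite (eq_code e (ltnSn k)).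
Qed.

Lemma measurable_backward_rank j (A : set nat) :
  measurable [set s : permN | A (backward_rank j s)].
Proof.
apply: (@measurable_finite_dep _ permN nat (fun v s => pos s v) j.+1).
  exact: measurable_pos.
by move=> s s' e /=; rewrite (eq_backward_rank e).
Qed.

Lemma measurable_proj_perm n (t : 'S_n) : measurable (proj_perm n @^-1` [set t]).
Proof.
rewrite (_ : _ @^-1` _ =
    \bigcap_(j in `I_n) [set s | backward_rank j s = backward_rank j (ext t)]).
  apply: fin_bigcap_measurable; first exact: finite_II.
  by move=> j _; exact: (measurable_backward_rank j [set backward_rank j (ext t)]).
by apply/seteqP; split=> s /= /proj_perm_eq.
Qed.

Section Mass.
Local Open Scope ring_scope.
Context d (T : measurableType d) (R : realType) (P : probability T R).

(** Real-valued probabilities, so that renewal equations can be subtracted, divided and passed to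
    the limit in a field. *)
Definition mass (A : set T) : R := fine (P A).

Lemma massE A : measurable A -> P A = (mass A)%:E.
Proof. by move=> mA; rewrite /mass fineK// fin_num_measure. Qed.

Lemma mass_ge0 A : 0 <= mass A.
Proof. by rewrite /mass fine_ge0. Qed.

Lemma mass_le A B : measurable A -> measurable B -> A `<=` B -> mass A <= mass B.
Proof.
move=> mA mB AB; rewrite -lee_fin -!massE//; apply: le_measure => //; exact: mem_set.
Qed.

Lemma mass_setT : mass setT = 1.
Proof. by rewrite /mass probability_setT. Qed.

Lemma mass_set0 : mass set0 = 0.
Proof. by rewrite /mass measure0. Qed.

Lemma mass_le1 A : measurable A -> mass A <= 1.
Proof. by move=> mA; rewrite -mass_setT mass_le. Qed.

Lemma mass_setC A : measurable A -> mass (~` A) = 1 - mass A.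
Proof.
move=> mA; apply: EFin_inj.
by rewrite -massE ?probability_setC ?massE//; exact: measurableC.
Qed.

Lemma massU A B : measurable A -> measurable B -> A `&` B = set0 ->
  mass (A `|` B) = mass A + mass B.
Proof.
move=> mA mB AB; apply: EFin_inj; rewrite EFinD -!massE//; last exact: measurableU.
by rewrite measureU//; exact/disj_set2P.
Qed.

Lemma massIC A B : measurable A -> measurable B ->
  mass A = mass (A `&` B) + mass (A `&` ~` B).
Proof.
move=> mA mB; rewrite -massU ?setIUr.
- by rewrite -setIUr setUv setIT.
- exact: measurableI.
- by apply: measurableI => //; exact: measurableC.
- by rewrite setIACA setICr setI0.
Qed.

Lemma mass_sum (I : finType) (A : set T) (F : I -> set T) :
  (forall i, measurable (F i)) -> (forall i j t, F i t -> F j t -> i = j) ->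
  A = \bigcup_i F i -> mass A = \sum_i mass (F i).
Proof.
move=> mF tF ->.
have -> : \bigcup_i F i = \bigcup_(i in [set` index_enum I]) F i.
  by apply/seteqP; split=> t [i _ Fi]; exists i => //=; rewrite mem_index_enum.
elim: (index_enum I) (index_enum_uniq I) => [_|i r IHr /= /andP[ir ur]].
  by rewrite big_nil set_nil bigcup_set0 mass_set0.
rewrite big_cons (_ : [set` i :: r] = i |` [set` r]); last first.
  apply/seteqP; split=> j /=; rewrite inE; last by case=> ->; rewrite ?eqxx ?orbT.
  by case/orP => [/eqP|]; [left|right].
rewrite bigcup_setU1 massU//.
- by rewrite IHr.
- by apply: fin_bigcup_measurable.
apply/seteqP; split=> // t [Fi [j /= jr Fj]].
by move: ir; rewrite (tF i j t Fi Fj) jr.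
Qed.

Lemma mass_cvg_up (F : nat -> set T) : (forall i, measurable (F i)) ->
  nondecreasing_seq F -> \bigcup_i F i = setT -> mass (F n) @[n --> \oo] --> (1 : R).
Proof.
move=> mF ndF UF; rewrite -mass_setT -UF; apply: fine_cvg.
rewrite -massE; last by rewrite UF.
by apply: nondecreasing_cvg_mu => //; rewrite UF.
Qed.

Lemma mass_cvg_down (F : nat -> set T) : (forall i, measurable (F i)) ->
  nonincreasing_seq F -> mass (F n) @[n --> \oo] --> mass (\bigcap_i F i).
Proof.
move=> mF niF; apply: fine_cvg; rewrite -massE; last exact: bigcap_measurableType.
apply: nonincreasing_cvg_mu => //; last exact: bigcap_measurableType.
by rewrite [X in (X < _)%E](massE (mF 0)) ltry.
Qed.

End Mass.

Section CountableLaw.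
Local Open Scope ring_scope.
Context d (T : measurableType d) (R : realType).

(** Two measures are allowed besides two maps, so that a restriction of [P] can be compared with a
    multiple of [P]. *)
Lemma eq_measure_count (m1 m2 : {measure set T -> \bar R}) (T' : countType)
    (X Y : T -> T') :
  (forall a, measurable (X @^-1` [set a])) ->
  (forall a, measurable (Y @^-1` [set a])) ->
  (forall a, m1 (X @^-1` [set a]) = m2 (Y @^-1` [set a])) ->
  forall A, m1 (X @^-1` A) = m2 (Y @^-1` A).
Proof.
move=> mX mY e A.
pose S n : set T' := [set a | A a /\ choice.pickle a = n].
have SE n : S n = set0 \/ exists a, S n = [set a].
  have [[a [Aa an]]|Sn] := pselect (exists a, S n a); last first.
    by left; apply/seteqP; split=> // a Sa; apply: Sn; exists a.
  right; exists a; apply/seteqP; split=> [b [_ bn]|b ->//].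
  by apply: (pcan_inj (@choice.pickleK T')); rewrite an bn.
have AE : A = \bigcup_n S n.
  by apply/seteqP; split=> [a Aa|a [n _ []//]]; exists (choice.pickle a).
have tS : trivIset setT S.
  apply/trivIsetP => i j _ _ /eqP ij; apply/seteqP; split=> // a [[_ ai] [_ aj]].
  by apply: ij; rewrite -ai -aj.
have H (m : {measure set T -> \bar R}) (Z : T -> T') :
    (forall a, measurable (Z @^-1` [set a])) ->
    (m (Z @^-1` A) = \sum_(n <oo) m (Z @^-1` S n))%E.
  move=> mZ; rewrite [in LHS]AE preimage_bigcup measure_semi_bigcup//.
  - by move=> i; exact: measurable_preimage_count.
  - move/trivIsetP : tS => tS; apply/trivIsetP => i j _ _ ij.
    by rewrite -preimage_setI tS// preimage_set0.
  - by apply: bigcup_measurable => i _; exact: measurable_preimage_count.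
rewrite !H//; apply: eq_eseriesr => n _.
by have [->|[a ->]] := SE n; rewrite ?preimage_set0 ?measure0.
Qed.

(** [Z] stands for a copy of [Y] in law, typically the same sequence read from index 0 instead of
    from a later one. The identity passes from points to sets in one variable at a time. *)
Lemma mass_count_prod (P : probability T R) (T1 T2 : countType)
    (X : T -> T1) (Y Z : T -> T2) :
  (forall a, measurable (X @^-1` [set a])) ->
  (forall b, measurable (Y @^-1` [set b])) ->
  (forall b, measurable (Z @^-1` [set b])) ->
  (forall a b, mass P (X @^-1` [set a] `&` Y @^-1` [set b]) =
     mass P (X @^-1` [set a]) * mass P (Z @^-1` [set b])) ->
  forall A B, mass P (X @^-1` A `&` Y @^-1` B) =
    mass P (X @^-1` A) * mass P (Z @^-1` B).
Proof.
move=> mX mY mZ H A B.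
have mX' := measurable_preimage_count mX.
have mY' := measurable_preimage_count mY.
have mZ' := measurable_preimage_count mZ.
pose c C := NngNum (mass_ge0 P C).
have step1 b : mass P (X @^-1` A `&` Y @^-1` [set b]) =
    mass P (X @^-1` A) * mass P (Z @^-1` [set b]).
  have /= := @eq_measure_count (mrestr P (mY b)) (mscale (c (Z @^-1` [set b])) P)
    T1 X X mX mX _ A.
  rewrite /mrestr /mscale /= => E; apply: EFin_inj.
  rewrite EFinM -!massE//; last exact: measurableI.
  rewrite E; first by rewrite muleC -(massE _ (mZ b)).
  move=> a; rewrite [LHS]massE; last exact: measurableI.
  by rewrite H EFinM muleC -(massE _ (mX a)).
have /= := @eq_measure_count (mrestr P (mX' A)) (mscale (c (X @^-1` A)) P)
  T2 Y Z mY mZ _ B.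
rewrite /mrestr /mscale /= => E; apply: EFin_inj.
rewrite EFinM -!massE//; last exact: measurableI.
rewrite setIC E; first by rewrite -(massE _ (mX' A)).
move=> b; rewrite setIC [LHS]massE; last exact: measurableI.
by rewrite step1 EFinM -(massE _ (mZ b)).
Qed.

End CountableLaw.

Local Open Scope ring_scope.

(** * Renewals under i.i.d. codes *)

Lemma eq0_of_mul_bounded (R : realType) (x K : R) :
  0 <= x -> (forall n : nat, n%:R * x <= K) -> x = 0.
Proof.
move=> x0 H; apply/eqP; rewrite eq_le x0 andbT leNgt; apply/negP => xp.
have := H (Num.truncn (K / x)).+1; rewrite leNgt => /negP; apply.
by rewrite -ltr_pdivrMr// truncnS_gt.
Qed.

Definition no_renewal (a b : nat) : set permN :=
  [set s | forall i, (a < i <= b)%N -> ~ renews s i].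

Lemma local_no_renewal a b : local b (no_renewal a b).
Proof.
move=> s s' e H i ib R; apply: (H i ib); move: R.
by apply: eq_renews => [|k kb]; [have /andP[_] := ib; apply|rewrite e].
Qed.

Lemma shiftp_no_renewal j (s : permN) a b : renews s j ->
  no_renewal a b (shiftp j s) <-> no_renewal (j + a) (j + b) s.
Proof.
move=> R; split=> H i /andP[ai ib].
  rewrite -(@subnKC j i); last by lia.
  by move/(proj2 (shiftp_renews _ R)); apply: H; lia.
by move/(proj1 (shiftp_renews _ R)); apply: H; lia.
Qed.

Lemma local_shiftp m n A B : local m A -> (forall s, A s -> renews s m) ->
  local n B -> local (m + n) (A `&` shiftp m @^-1` B).
Proof.
move=> lA AR lB s s' e [As Bs].
have As' : A s' by apply: lA As => i im; apply: e; rewrite ltn_addr.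
split=> //; apply: lB Bs => i ni; rewrite !shiftpE ?e ?ltn_add2l//; exact: AR.
Qed.

Section CodeLaw.
Context {R : realType} (P : probability permN R) (pr : nat -> R).

Definition code_law := forall n (a : nat -> nat),
  mass P [set s | forall k, (k < n)%N -> code s k = a k] =
  \prod_(k < n) pr (a k).

Hypothesis Hc : code_law.

Lemma mass_word n (s0 : permN) :
  mass P [set s : permN | forall k, (k < n)%N -> s k = s0 k] =
  \prod_(k < n) pr (code s0 k).
Proof.
rewrite -Hc; congr mass; apply/seteqP; split=> s /= e k kn.
  exact: eq_code e k kn.
exact: code_inj e k kn.
Qed.

(** Split along the permutation t of [m] that [s] induces. Its mass is a product over codes, which
    is also a product over backward ranks, and the sum over t then factors; a t with a forbidden
    rank contributes 0. *)
Lemma mass_renews_backward_rank m (B : nat -> pred nat) :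
  mass P [set s | renews s m /\ forall j, (j < m)%N -> B j (backward_rank j s)] =
  \prod_(j < m) \sum_(i < j.+1 | B j i) pr i.
Proof.
pose F (t : 'S_m) := [set s : permN | (forall k, (k < m)%N -> s k = ext t k) /\
  forall j, (j < m)%N -> B j (backward_rank j (ext t))].
have FE t : mass P (F t) = \prod_(j < m)
    (if B j (backward_rank j (ext t)) then pr (backward_rank j (ext t)) else 0).
  have [Bt|nBt] := pselect (forall j, (j < m)%N -> B j (backward_rank j (ext t))).
    rewrite (_ : F t = [set s : permN | forall k, (k < m)%N -> s k = ext t k]).
      rewrite mass_word prod_code_backward_rank; apply: eq_bigr => j _.
      by rewrite Bt.
    by apply/seteqP; split=> s => [[]|].
  rewrite (_ : F t = set0); last by apply/seteqP; split=> // s [_ /nBt].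
  have [j nBj] : exists j : 'I_m, ~~ B j (backward_rank j (ext t)).
    apply: contra_notP nBt => nB j jm; apply: contra_notT nB => nBj.
    by exists (Ordinal jm).
  by rewrite mass_set0 (bigD1 j)//= (negbTE nBj) mul0r.
rewrite (@mass_sum _ _ _ P _ _ F).
- rewrite (eq_bigr _ (fun t _ => FE t)).
  rewrite (sum_prod_backward_rank _ (fun j i => if B j i then pr i else 0)).
  by apply: eq_bigr => j _; rewrite [RHS]big_mkcond.
- move=> t; apply: (@measurable_local m) => s s' e [es Bt].
  by split=> // k km; rewrite -e// es.
- move=> t t' s [es _] [es' _]; apply: ext_inj => i im.
  by rewrite -es// es'.
apply/seteqP; split=> s.
  move=> [Rs Bs]; exists (proj_perm m s) => //; split.
    by move=> k km; rewrite -renews_proj_perm.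
  by move=> j jm; rewrite backward_rank_proj//; exact: Bs.
move=> [t _ [es Bt]].
have es' k : (k < m)%N -> ext t k = s k by move=> km; rewrite es.
split; first exact: eq_renews (leqnn m) es' (renews_ext t).
move=> j jm; rewrite -(@eq_backward_rank (ext t)) ?Bt// => v vj.
by apply: (eq_pos_renews es' (renews_ext t)); apply: leq_ltn_trans jm.
Qed.

Definition renewal_prob m := mass P [set s | renews s m].
Definition no_renewal_prob n := mass P (no_renewal 0 n).

Lemma renewal_prob_prod m : renewal_prob m = \prod_(j < m) \sum_(i < j.+1) pr i.
Proof.
rewrite /renewal_prob (_ : [set s | _] = [set s | renews s m /\
    forall j, (j < m)%N -> predT (backward_rank j s)]).
  exact: (mass_renews_backward_rank m (fun=> predT)).
by apply/seteqP; split=> s => [|[]].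
Qed.

Lemma renewal_prob0 : renewal_prob 0 = 1.
Proof. by rewrite renewal_prob_prod big_ord0. Qed.

Let pre n (s : permN) := [seq code s k | k <- iota 0 n].
Let spre m n (s : permN) := [seq code s (m + k) | k <- iota 0 n].

Lemma seq_code_eq (f : nat -> nat) n w :
  [seq f k | k <- iota 0 n] = w <->
  size w = n /\ forall k, (k < n)%N -> f k = nth 0%N w k.
Proof.
split=> [<-|[sw H]].
  rewrite size_map size_iota; split=> // k kn.
  by rewrite (nth_map 0%N) ?size_iota// nth_iota.
apply: (@eq_from_nth _ 0%N); rewrite size_map size_iota// => k kn.
by rewrite (nth_map 0%N) ?size_iota// nth_iota// H.
Qed.

Lemma mass_pre n w : mass P (pre n @^-1` [set w]) =
  if size w == n then \prod_(k < n) pr (nth 0%N w k) else 0.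
Proof.
case: eqP => [sw|nsw].
  rewrite -Hc; congr mass; apply/seteqP; split=> s /=.
    by case/seq_code_eq.
  by move=> H; apply/seq_code_eq.
rewrite (_ : _ @^-1` _ = set0) ?mass_set0//.
by apply/seteqP; split=> // s /= /seq_code_eq[].
Qed.

(** [A] is an event on the first m codes. On [A] the codes of the shifted permutation are the next
    codes of [s], so the intersection is a product event of i.i.d. codes. *)
Lemma mass_regeneration m n A B : local m A -> (forall s, A s -> renews s m) ->
  local n B -> mass P (A `&` shiftp m @^-1` B) = mass P A * mass P B.
Proof.
move=> lA AR lB.
have AE : A = pre m @^-1` (pre m @` A).
  apply/seteqP; split=> [s As|s [s0 As0 e]]; first by exists s.
  apply: lA As0; apply: code_inj => k km.
  by move/seq_code_eq : e => [_ ->//]; rewrite (nth_map 0%N) ?size_iota// nth_iota.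
have BE s : B s <-> (pre n @` B) (pre n s).
  split=> [Bs|[s0 Bs0 e]]; first by exists s.
  apply: lB Bs0; apply: code_inj => k km.
  by move/seq_code_eq : e => [_ ->//]; rewrite (nth_map 0%N) ?size_iota// nth_iota.
have BE' : B = pre n @^-1` (pre n @` B).
  by apply/seteqP; split=> s /BE.
(* Reading the codes of [s] from m on gets rid of the junk value of [shiftp], which is harmless on
   [A] only. *)
have -> : A `&` shiftp m @^-1` B =
    pre m @^-1` (pre m @` A) `&` spre m n @^-1` (pre n @` B).
  rewrite -AE; apply/seteqP; split=> s [As] /=.
    move/BE; rewrite /pre; under eq_map => k do rewrite (shiftp_code _ (AR _ As)).
    by [].
  move=> H; split=> //; apply/BE; rewrite /pre.
  by under eq_map => k do rewrite (shiftp_code _ (AR _ As)).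
have mc k a : measurable ((fun s => code s k) @^-1` [set a]).
  exact: measurable_code.
rewrite [in RHS]AE [in RHS]BE'.
apply: mass_count_prod; try exact: measurable_prefix.
move=> a b; rewrite !mass_pre.
have [sa|sa] := eqVneq (size a) m; last first.
  rewrite mul0r (_ : _ `&` _ = set0) ?mass_set0//.
  by apply/seteqP; split=> // s /= [/seq_code_eq[e]]; rewrite e eqxx in sa.
have [sb|sb] := eqVneq (size b) n; last first.
  rewrite mulr0 (_ : _ `&` _ = set0) ?mass_set0//.
  by apply/seteqP; split=> // s /= [_ /seq_code_eq[e]]; rewrite e eqxx in sb.
transitivity (\prod_(k < m + n) pr (nth 0%N (a ++ b) k)).
  rewrite -Hc; congr mass; apply/seteqP; split=> s /=.
    move=> [/seq_code_eq[_ Ha] /seq_code_eq[_ Hb]] k kmn.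
    rewrite nth_cat sa; case: ltnP => km; first exact: Ha.
    by rewrite -Hb ?subnKC//; lia.
  move=> H; split; apply/seq_code_eq; split=> // k lt.
    by rewrite H ?ltn_addr// nth_cat sa lt.
  by rewrite H ?ltn_add2l// nth_cat sa ltnNge leq_addr/= addKn.
rewrite big_split_ord; congr (_ * _); apply: eq_bigr => k _ /=.
  by rewrite nth_cat sa ltn_ord.
by rewrite nth_cat sa ltnNge leq_addr/= addKn.
Qed.

(** The index j is the last renewal up to m, which exists because 0 is a renewal. *)
Lemma last_renewal_sum m n :
  mass P (no_renewal m (m + n)) =
  \sum_(j < m.+1) renewal_prob j * no_renewal_prob (m + n - j).
Proof.
pose F (j : 'I_m.+1) := [set s | renews s j] `&`
  shiftp j @^-1` (no_renewal 0 (m + n - j)).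
have jm (j : 'I_m.+1) : (j <= m + n)%N by have := ltn_ord j; lia.
have FE (j : 'I_m.+1) s : F j s <-> renews s j /\ no_renewal j (m + n) s.
  split=> -[Rj]; rewrite /= => H; split=> //.
    by move/(shiftp_no_renewal _ _ Rj): H; rewrite addn0 subnKC.
  by apply/(shiftp_no_renewal _ _ Rj); rewrite addn0 subnKC.
rewrite (@mass_sum _ _ _ P _ _ F).
- apply: eq_bigr => j _; apply: mass_regeneration => //.
    exact: local_renews.
  exact: local_no_renewal.
- move=> j; apply: (@measurable_local (j + (m + n - j))); apply: local_shiftp => //.
    exact: local_renews.
  exact: local_no_renewal.
- move=> i j s /FE[Ri Ni] /FE[Rj Nj]; apply: val_inj => /=.
  have [ij|ji|//] := ltngtP i j; exfalso.
    by apply: (Ni j) Rj; rewrite ij jm.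
  by apply: (Nj i) Ri; rewrite ji jm.
apply/seteqP; split=> s.
  move=> H.
  have ex : exists j, (j <= m)%N && `[< renews s j >].
    by exists 0%N; apply/asboolP; exact: renews0.
  have ub j : (j <= m)%N && `[< renews s j >] -> (j <= m)%N by case/andP.
  case: (ex_maxnP ex ub) => j /andP[lejm /asboolP Rj] maxj.
  exists (Ordinal (lejm : (j < m.+1)%N)) => //; apply/FE; split=> // i /=.
  move=> /andP[ji imn] Ri.
  have [im|mi] := leqP i m; last by apply: (H i) Ri; rewrite mi.
  by have := maxj i; rewrite im leqNgt ji => /(_ (asboolT Ri)).
move=> [j _ /FE[Rj Nj]] i /andP[mi imn]; apply: Nj; rewrite imn andbT.
by have := ltn_ord j; lia.
Qed.

Definition first_renewal (n k : nat) : set permN :=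
  [set s | renews s k /\ forall i, (n <= i < k)%N -> ~ renews s i].

Lemma local_first_renewal n k : local k (first_renewal n k).
Proof.
move=> s s' e [Rk H]; split; first exact: eq_renews e Rk.
move=> i /andP[ni ik] Ri; apply: (H i); rewrite ?ni//.
by apply: (@eq_renews s' s k) Ri => [|j jk]; [exact: ltnW|rewrite e].
Qed.

(** [A] itself need not be local: an event on the backward ranks of the first n letters depends on
    finitely many letters only once a renewal from n on is known. *)
Lemma first_renewal_sum n m (A : set permN) : measurable A ->
  (forall k, (n <= k)%N -> local k (A `&` [set s | renews s k])) -> (n <= m)%N ->
  mass P (A `&` [set s | renews s m]) =
  \sum_(k < (m - n).+1) mass P (A `&` first_renewal n (n + k)) * renewal_prob (m - n - k).
Proof.
move=> mA lA nm.
pose F (k : 'I_(m - n).+1) := (A `&` first_renewal n (n + k)) `&`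
  shiftp (n + k) @^-1` [set s | renews s (m - n - k)].
have km (k : 'I_(m - n).+1) : (n + k + (m - n - k) = m)%N by have := ltn_ord k; lia.
have lAF k : local (n + k) (A `&` first_renewal n (n + k)).
  move=> s s' e [As [Rs Hs]].
  have [As' Rs'] : (A `&` [set s | renews s (n + k)]) s'.
    by apply: (lA _ (leq_addr k n)) e _.
  by split=> //; apply: local_first_renewal e _.
have FE (k : 'I_(m - n).+1) s :
    F k s <-> [/\ A s, first_renewal n (n + k) s & renews s m].
  split=> [[[As Fs]]|[As Fs Rs]] /=.
    by move=> /(shiftp_renews _ (proj1 Fs)); rewrite km.
  by split=> //; apply/(shiftp_renews _ (proj1 Fs)); rewrite km.
rewrite (@mass_sum _ _ _ P _ _ F).
- apply: eq_bigr => k _; apply: mass_regeneration => //.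
    by move=> s [_ []].
  exact: local_renews.
- move=> k; apply: (@measurable_local (n + k + (m - n - k))); apply: local_shiftp => //.
    by move=> s [_ []].
  exact: local_renews.
- move=> i j s /FE[_ [Ri Hi] _] /FE[_ [Rj Hj] _]; apply: val_inj => /=.
  have [ij|ji|//] := ltngtP i j; exfalso.
    by apply: (Hj (n + i)%N) Ri; rewrite leq_addr ltn_add2l.
  by apply: (Hi (n + j)%N) Rj; rewrite leq_addr ltn_add2l.
apply/seteqP; split=> s; last by move=> [k _ /FE[]].
move=> [As Rm].
have ex : exists k, (n <= k)%N && `[< renews s k >].
  by exists m; rewrite nm; apply/asboolP.
case: (ex_minnP ex) => k /andP[nk /asboolP Rk] mink.
have km' : (k - n < (m - n).+1)%N.
  rewrite ltnS leq_sub2r// mink// nm; exact/asboolP.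
exists (Ordinal km') => //; apply/FE; split=> //=; rewrite subnKC//; split=> //.
move=> i /andP[ni ik] Ri; have := mink i; rewrite ni leqNgt ik.
by move/(_ (asboolT Ri)).
Qed.

End CodeLaw.

(** * Independence from product formulas *)

Section Words.
Context d (T : measurableType d) (R : realType) (P : probability T R).

Lemma mass_ae_eq (N A B : set T) : measurable N -> mass P N = 1 ->
  measurable A -> measurable B -> (forall t, N t -> A t <-> B t) ->
  mass P A = mass P B.
Proof.
move=> mN N1 mA mB AB.
have H C : measurable C -> mass P C = mass P (C `&` N).
  move=> mC; rewrite (massIC P mC mN).
  suff -> : mass P (C `&` ~` N) = 0 by rewrite addr0.
  apply/eqP; rewrite eq_le mass_ge0 andbT -(subrr 1) -[X in _ <= _ - X]N1.
  rewrite -mass_setC//; apply: mass_le => //.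
  - by apply: measurableI => //; exact: measurableC.
  - exact: measurableC.
by rewrite H// (H B)//; congr mass; apply/seteqP; split=> t [? Nt]; split=> //;
  apply/(AB _ Nt).
Qed.

(** Laws of codes and of blocks are known only on single words. Induction on the length extends them
    to boxes of sets, one coordinate at a time. *)
Lemma mass_product_of_words (T' : countType) (X : nat -> T -> T') (q : T' -> R) :
  (forall i a, measurable (X i @^-1` [set a])) ->
  (forall w, mass P (X 0 @^-1` [set w]) = q w) ->
  (forall ws, mass P [set t | [seq X i t | i <- iota 0 (size ws)] = ws] =
              \prod_(w <- ws) q w) ->
  forall n (B : nat -> set T'),
  mass P [set t | forall k, (k < n)%N -> B k (X k t)] =
  \prod_(k < n) mass P (X 0 @^-1` B k).
Proof.
move=> mX q0 H n B; elim: n => [|n IHn].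
  rewrite big_ord0 -(mass_setT P); congr mass.
  by apply/seteqP; split=> // t _ k.
pose pre t := [seq X i t | i <- iota 0 n].
pose C := [set ws : seq T' | forall k a0, (k < n)%N -> B k (nth a0 ws k)].
have Cpre : [set t | forall k, (k < n)%N -> B k (X k t)] = pre @^-1` C.
  apply/seteqP; split=> t /= Ht k.
    by move=> a0 kn; rewrite (nth_map 0%N) ?size_iota// nth_iota//; exact: Ht.
  move=> kn; have := Ht k (X 0 t) kn.
  by rewrite (nth_map 0%N) ?size_iota// nth_iota.
rewrite big_ord_recr /= -IHn Cpre.
rewrite (_ : [set t | _] = pre @^-1` C `&` X n @^-1` B n); last first.
  rewrite -Cpre; apply/seteqP; split=> t /= Ht.
    by split=> [k kn|]; apply: Ht => //; exact: ltnW.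
  by move=> k; rewrite ltnS leq_eqVlt => /predU1P[->|]; apply Ht.
apply: mass_count_prod => //; first exact: measurable_prefix.
move=> ws w; rewrite q0.
have [sw|nsw] := eqVneq (size ws) n; last first.
  have E : pre @^-1` [set ws] = set0.
    apply/seteqP; split=> // t /= e.
    by move: nsw; rewrite -e size_map size_iota eqxx.
  by rewrite E set0I mass_set0 mul0r.
have -> : mass P (pre @^-1` [set ws]) = \prod_(w0 <- ws) q w0 by rewrite -H sw.
have := H (rcons ws w).
rewrite big_rcons/= => <-; congr mass; apply/seteqP; split=> t /=.
  by move=> [e <-]; rewrite size_rcons -addn1 iotaD map_cat sw cats1 -/(pre t) e.
rewrite size_rcons -addn1 iotaD map_cat sw cats1 -/(pre t) => /eqP.
by rewrite eqseq_rcons => /andP[/eqP -> /eqP ->].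
Qed.

(** Full sets give [q k setT = 1] by induction, so the factors turn out to be the marginals. A
    finite index set is then filled up to an initial segment with full sets. *)
Lemma independent_of_product d' (T' : measurableType d') (X : nat -> T -> T')
    (q : nat -> set T' -> R) :
  (forall n (B : nat -> set T'), (forall i, measurable (B i)) ->
    mass P [set t | forall k, (k < n)%N -> B k (X k t)] = \prod_(k < n) q k (B k)) ->
  (forall i (A : set T'), measurable A -> measurable (X i @^-1` A)) ->
  independent_seq P X /\
  forall i (A : set T'), measurable A -> P (X i @^-1` A) = (q i A)%:E.
Proof.
move=> H mX.
have qT k : q k setT = 1.
  elim/ltn_ind: k => k IHk.
  have := H k.+1 (fun=> setT) (fun=> measurableT).
  rewrite (_ : [set t | _] = setT); last by apply/seteqP; split.
  rewrite mass_setT big_ord_recr/= big1 ?mul1r// => i _.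
  by rewrite IHk.
have marg i (A : set T') : measurable A -> mass P (X i @^-1` A) = q i A.
  move=> mA; have := H i.+1 (fun k => if k == i then A else setT).
  rewrite big_ord_recr/= eqxx big1 ?mul1r => [<-|k _].
  - congr mass; apply/seteqP; split=> t /= At; last first.
      by have := At i (ltnSn i); rewrite eqxx.
    by move=> k _; case: eqP => // ->.
  - by move=> k; case: ifP.
  - by rewrite ltn_eqF.
split; last by move=> i A mA; rewrite -marg// massE//; exact: mX.
move=> J A mA.
pose n := (\max_(i <- J) i).+1.
have Jn i : i \in J -> (i < n)%N.
  by move=> iJ; rewrite ltnS; apply: leq_bigmax_seq.
have := H n (fun k => if k \in J then A k else setT).
rewrite (_ : [set t | _] = \bigcap_(i in [set` J]) (X i @^-1` A i)); last first.
  apply/seteqP; split=> t /= Ht i.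
    by move=> /= iJ; have := Ht i (Jn i iJ); rewrite iJ.
  by move=> _; case: ifPn => // iJ; exact: Ht.
move=> E; rewrite massE; last first.
  by apply: fin_bigcap_measurable => // i _; exact: mX.
rewrite E; last by move=> i; case: ifP.
rewrite (eq_bigr (fun i => (mass P (X i @^-1` A i))%:E)); last first.
  by move=> i _; rewrite massE//; exact: mX.
rewrite prodEFin; congr EFin.
transitivity (\prod_(k < n | val k \in J) q k (A k)).
  rewrite [RHS]big_mkcond; apply: eq_bigr => k _.
  by case: ifP.
rewrite -(big_mkord (fun k => k \in J) (fun k => q k (A k))).
rewrite -big_filter; apply/esym.
rewrite (perm_big [seq k <- index_iota 0 n | k \in J]); last first.
  apply: uniq_perm; rewrite ?filter_uniq ?iota_uniq ?fset_uniq//.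
  move=> i; rewrite mem_filter mem_index_iota leq0n/=.
  by case iJ : (i \in J) => //=; rewrite Jn.
by apply: eq_bigr => i _; exact: marg.
Qed.

Lemma independent_prefix d' (T' : measurableType d') (X : nat -> T -> T')
    (A : nat -> set T') n : independent_seq P X -> (forall i, measurable (A i)) ->
  (forall i, measurable (X i @^-1` A i)) ->
  mass P [set t | forall k, (k < n)%N -> A k (X k t)] =
  \prod_(k < n) mass P (X k @^-1` A k).
Proof.
move=> indX mA mX; pose J : {fset nat} := [fset k in iota 0 n]%fset.
have JE k : (k \in J) = (k < n)%N by rewrite !inE mem_iota.
rewrite (_ : [set t | _] = \bigcap_(k in [set` J]) (X k @^-1` A k)); last first.
  apply/seteqP; split=> t H k /=; rewrite ?JE => kn; first exact: H.
  by apply: H; rewrite /= JE.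
rewrite /mass (indX J A mA) (eq_bigr (fun k => (mass P (X k @^-1` A k))%:E)); last first.
  by move=> k _; rewrite -massE.
rewrite prodEFin/= (perm_big (iota 0 n)); last first.
  by apply: uniq_perm; rewrite ?fset_uniq ?iota_uniq// => k; rewrite JE mem_iota.
by rewrite -[n in LHS]subn0 -/(index_iota 0 n) big_mkord.
Qed.

End Words.

(** * Almost sure renewals and independence of the backward ranks *)

Definition infinitely_renewing : set permN :=
  [set s | forall m, exists2 i, (m < i)%N & renews s i].

Lemma infinitely_renewingE :
  infinitely_renewing = ~` \bigcup_m \bigcap_n no_renewal m (m + n).
Proof.
apply/seteqP; split=> s.
  by move=> H [m _ Hm]; have [i mi Ri] := H m; apply: (Hm (i - m)%N I i) Ri; lia.
move=> H m; apply: contrapT => nR; apply: H; exists m => // n _ i /andP[mi _] Ri.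
by apply: nR; exists i.
Qed.

Lemma measurable_no_renewal a b : measurable (no_renewal a b).
Proof. exact: measurable_local (@local_no_renewal a b). Qed.

Lemma measurable_infinitely_renewing : measurable infinitely_renewing.
Proof.
rewrite infinitely_renewingE; apply: measurableC.
apply: bigcup_measurable => m _; apply: bigcap_measurableType => n _.
exact: measurable_no_renewal.
Qed.

Lemma shiftp_infinitely_renewing m (s : permN) : renews s m ->
  infinitely_renewing s -> infinitely_renewing (shiftp m s).
Proof.
move=> R H k; have [i mi Ri] := H (m + k)%N; exists (i - m)%N; first by lia.
by apply/shiftp_renews => //; rewrite subnKC//; lia.
Qed.

Lemma no_renewalW a b c : (b <= c)%N -> no_renewal a c `<=` no_renewal a b.
Proof. by move=> bc s H i /andP[ai ib]; apply: H; rewrite ai (leq_trans ib). Qed.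

Section Renewal.
Context {R : realType} (P : probability permN R) (pr : nat -> R).
Hypothesis Hc : code_law P pr.
Lemma no_renewal_prob_ge0 n : 0 <= no_renewal_prob P n. Proof. exact: mass_ge0. Qed.

Lemma no_renewal_prob_nincr m n :
  (m <= n)%N -> no_renewal_prob P n <= no_renewal_prob P m.
Proof.
move=> mn; apply: mass_le; first exact: measurable_no_renewal.
  exact: measurable_no_renewal.
exact: no_renewalW.
Qed.

Lemma renewal_identity m :
  \sum_(j < m.+1) renewal_prob P j * no_renewal_prob P (m - j) = 1.
Proof.
have := last_renewal_sum Hc m 0; rewrite addn0 => <-.
rewrite -(mass_setT P); congr mass; apply/seteqP; split=> // s _ i; lia.
Qed.

Variable U : R.
Hypothesis U0 : 0 < U.
Hypothesis HU : forall m, U <= renewal_prob P m.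

Lemma sum_no_renewal_prob_le n : \sum_(j < n) no_renewal_prob P j <= U^-1.
Proof.
case: n => [|n]; first by rewrite big_ord0 invr_ge0 ltW.
rewrite -(ler_pM2l U0) mulfV ?gt_eqF// -(renewal_identity n) big_distrr/=.
rewrite [leRHS](reindex_inj rev_ord_inj)/=; apply: ler_sum => j _.
rewrite subSS (subKn (ltnSE (ltn_ord j))).
by apply: ler_wpM2r; [exact: no_renewal_prob_ge0|exact: HU].
Qed.

Lemma no_renewal_prob_le n : n%:R * no_renewal_prob P n <= U^-1.
Proof.
apply: le_trans (sum_no_renewal_prob_le n).
have -> : n%:R * no_renewal_prob P n = \sum_(j < n) no_renewal_prob P n.
  by rewrite sumr_const card_ord mulr_natl.
by apply: ler_sum => j _; apply: no_renewal_prob_nincr; exact: ltnW (ltn_ord j).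
Qed.

(** After each of the m + 1 possible last renewals up to m comes a stretch of length at least n
    without renewal. *)
Lemma no_renewal_le m n : mass P (no_renewal m (m + n)) <= m.+1%:R * no_renewal_prob P n.
Proof.
rewrite (last_renewal_sum Hc) mulr_natl -[m.+1 in X in _ <= X]card_ord -sumr_const.
apply: ler_sum => j _; rewrite -[leRHS]mul1r; apply: ler_pM.
- exact: mass_ge0.
- exact: mass_ge0.
- apply: mass_le1; exact: measurable_renews.
by apply: no_renewal_prob_nincr; have := ltn_ord j; lia.
Qed.

Lemma no_renewal_bound m n :
  n%:R * mass P (no_renewal m (m + n)) <= m.+1%:R * U^-1.
Proof.
apply: le_trans (_ : n%:R * (m.+1%:R * no_renewal_prob P n) <= _).
  by apply: ler_wpM2l; [exact: ler0n|exact: no_renewal_le].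
by rewrite mulrCA; apply: ler_wpM2l; [exact: ler0n|exact: no_renewal_prob_le].
Qed.

(** For fixed m, a stretch of length n without renewal after m has probability O(1/n) by
    [no_renewal_bound]. *)
Lemma infinitely_renewing_ae : P (~` infinitely_renewing) = 0%E.
Proof.
rewrite infinitely_renewingE setCK.
have mN m : measurable (\bigcap_n no_renewal m (m + n)).
  by apply: bigcap_measurableType => n _; exact: measurable_no_renewal.
apply: measure_negligible; first exact: bigcup_measurable.
apply: negligible_bigcup => m; apply/(negligibleP P (mN m)).
apply: etrans (massE P (mN m)) _; congr EFin.
apply: (@eq0_of_mul_bounded _ _ (m.+1%:R * U^-1)); first exact: mass_ge0.
move=> n; apply: le_trans (no_renewal_bound m n).
apply: ler_wpM2l; first exact: ler0n.
apply: mass_le => //; first exact: measurable_no_renewal.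
by move=> s; apply.
Qed.

Lemma mass_infinitely_renewing : mass P infinitely_renewing = 1.
Proof.
rewrite -[infinitely_renewing]setCK mass_setC.
  by rewrite /mass infinitely_renewing_ae/= subr0.
apply: measurableC; exact: measurable_infinitely_renewing.
Qed.

Lemma pr_sum_neq0 j : \sum_(i < j.+1) pr i != 0.
Proof.
have : renewal_prob P j.+1 != 0 by rewrite gt_eqF// (lt_le_trans U0).
by rewrite (renewal_prob_prod Hc) big_ord_recr/= mulf_eq0 negb_or => /andP[].
Qed.

Lemma mass_backward_rank n (B : nat -> pred nat) :
  mass P [set s | forall j, (j < n)%N -> B j (backward_rank j s)] =
  \prod_(j < n) ((\sum_(i < j.+1 | B j i) pr i) / \sum_(i < j.+1) pr i).
Proof.
set A := [set s | _]; set c := \prod_(j < n) _.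
have mA : measurable A.
  rewrite (_ : A = \bigcap_(j in `I_n) [set s | B j (backward_rank j s)])//.
  apply: fin_bigcap_measurable; first exact: finite_II.
  by move=> j _; exact: (measurable_backward_rank j (fun i => B j i)).
have lA k : (n <= k)%N -> local k (A `&` [set s | renews s k]).
  move=> nk s s' e [As Rs]; split; last exact: eq_renews e Rs.
  move=> j jn; rewrite -(@eq_backward_rank s) ?As// => v vj.
  by apply: (eq_pos_renews e Rs); lia.
have lT k : (n <= k)%N -> local k (setT `&` [set s | renews s k]).
  by move=> _; rewrite setTI; exact: local_renews.
have AR m : (n <= m)%N -> mass P (A `&` [set s | renews s m]) = c * renewal_prob P m.
  move=> nm; pose B' j i := (j < n)%N ==> B j i.
  rewrite (_ : A `&` _ = [set s | renews s m /\
      forall j, (j < m)%N -> B' j (backward_rank j s)]); last first.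
    apply/seteqP; split=> s /=.
      by move=> [As Rs]; split=> // j _; apply/implyP => /As.
    move=> [Rs Bs]; split=> // j jn; have := Bs j (leq_trans jn nm).
    by rewrite /B' jn.
  rewrite (mass_renews_backward_rank Hc) (renewal_prob_prod Hc) -(subnKC nm).
  rewrite !big_split_ord.
  rewrite mulrA -big_split/=; congr (_ * _).
    apply: eq_bigr => j _; rewrite divfK ?pr_sum_neq0//.
    by apply: eq_bigl => i; rewrite /B' ltn_ord.
  apply: eq_bigr => j _; apply: eq_bigl => i.
  by rewrite /B' ltnNge leq_addr.
(* Both sides solve the same triangular renewal equation, as u_0 = 1. *)
have xy k : mass P (A `&` first_renewal n (n + k)) =
    c * mass P (setT `&` first_renewal n (n + k)).
  elim/ltn_ind: k => k IHk.
  have := AR (n + k)%N (leq_addr k n).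
  have -> : renewal_prob P (n + k) = \sum_(i < (n + k - n).+1)
      mass P (setT `&` first_renewal n (n + i)) * renewal_prob P (n + k - n - i).
    by rewrite -(first_renewal_sum Hc measurableT lT (leq_addr k n)) setTI.
  rewrite (first_renewal_sum Hc mA lA (leq_addr k n)) addKn !big_ord_recr/=.
  rewrite subnn (renewal_prob0 Hc) !mulr1 mulrDr big_distrr/=.
  rewrite (eq_bigr (fun i : 'I_k => c * (mass P (setT `&` first_renewal n (n + i)) *
    renewal_prob P (k - i)))); first by move/addrI.
  by move=> i _; rewrite IHk// mulrA.
(* Some renewal in [n, n + M): on this event the proportionality with factor c can be summed over
   the first renewal. *)
pose E M := [set s : permN | exists k : 'I_M, renews s (n + k)].
have lE M : local (n + M) (E M).
  move=> s s' e [k Rk]; exists k; apply: (@eq_renews s s' (n + M)) Rk => //.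
  by rewrite leq_add2l ltnW.
have mE M : measurable (E M) by exact: measurable_local (lE M).
have split_E (C : set permN) M : measurable C ->
    (forall k, (n <= k)%N -> local k (C `&` [set s | renews s k])) ->
    mass P (C `&` E M) = \sum_(k < M) mass P (C `&` first_renewal n (n + k)).
  move=> mC lC; rewrite (@mass_sum _ _ _ P _ _
    (fun k : 'I_M => C `&` first_renewal n (n + k)))//.
  - move=> k; apply: measurableI => //.
    exact: measurable_local (@local_first_renewal n (n + k)).
  - move=> i j s [_ [Ri Hi]] [_ [Rj Hj]]; apply: val_inj => /=.
    have [ij|ji|//] := ltngtP i j; exfalso.
      by apply: (Hj (n + i)%N) Ri; rewrite leq_addr ltn_add2l.
    by apply: (Hi (n + j)%N) Rj; rewrite leq_addr ltn_add2l.
  apply/seteqP; split=> s; last first.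
    by move=> [k _ [Cs [Rk _]]]; split=> //; exists k.
  move=> [Cs [k0 Rk0]].
  have ex : exists k, `[< renews s (n + k) >] by exists k0; apply/asboolP.
  case: (ex_minnP ex) => k /asboolP Rk mink.
  have kM : (k < M)%N by apply: leq_ltn_trans (ltn_ord k0); apply/mink/asboolP.
  exists (Ordinal kM) => //; split=> //; split=> // i /= /andP[ni ik] Ri.
  have := mink (i - n)%N; rewrite subnKC// => /(_ (asboolT Ri)); lia.
have xyE M : mass P (A `&` E M) = c * mass P (E M).
  rewrite -[E M in RHS]setTI !split_E// big_distrr/=.
  by apply: eq_bigr => k _; exact: xy.
apply/eqP; rewrite -subr_eq0 -normr_eq0; apply/eqP.
(* Off the event of a renewal near n, the error is at most its probability times 1 + |c|; after
   multiplication by M, [no_renewal_bound] gives this constant. *)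
apply: (@eq0_of_mul_bounded _ _ ((1 + `|c|) * (n.+1%:R * U^-1))) => // M.
apply: le_trans (_ : (1 + `|c|) * (M%:R * mass P (no_renewal n (n + M))) <= _);
  last first.
  apply: ler_wpM2l; last exact: no_renewal_bound.
  by rewrite addr_ge0.
rewrite mulrCA; apply: ler_wpM2l; first exact: ler0n.
(* The successor makes the window of [E] include n + M, the right end of the interval. *)
have nE : ~` E M.+1 `<=` no_renewal n (n + M).
  move=> s nEs i /andP[ni iM] Ri; apply: nEs.
  have iM' : (i - n < M.+1)%N by lia.
  by exists (Ordinal iM'); rewrite /= subnKC// ltnW.
apply: le_trans (_ : (1 + `|c|) * mass P (~` E M.+1) <= _); last first.
  apply: ler_wpM2l; first by rewrite addr_ge0.
  apply: mass_le => //; first exact: measurableC.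
  exact: measurable_no_renewal.
have -> : mass P A - c = mass P (A `&` ~` E M.+1) - c * mass P (~` E M.+1).
  rewrite (massIC P mA (mE M.+1)) xyE mass_setC//; ring.
apply: le_trans (ler_normB _ _) _.
rewrite mulrDl mul1r normrM !(ger0_norm (mass_ge0 _ _)) lerD2r.
apply: mass_le => //; last exact: measurableC.
by apply: measurableI => //; exact: measurableC.
Qed.

Lemma independent_backward_rank :
  independent_seq P (fun k => backward_rank k.+1).
Proof.
pose q (j : nat) (A : set nat) :=
  (\sum_(i < j.+1 | (i : nat) \in A) pr i) / \sum_(i < j.+1) pr i.
apply: (independent_of_product (q := fun j => q j.+1) _ _).1 => [n B _|j A _].
  (* The ranks start at index 1 in the statement; index 0 gets the trivial constraint, whose factor
     is pr 0 / pr 0 = 1. *)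
  pose B' (j : nat) : pred nat :=
    if j is j'.+1 then fun i => i \in B j' else fun=> true.
  rewrite (_ : [set t | _] =
      [set s | forall j, (j < n.+1)%N -> B' j (backward_rank j s)]).
    rewrite mass_backward_rank big_ord_recl/= big_ord1 mulfV ?mul1r//.
    by have := pr_sum_neq0 0; rewrite big_ord1.
  apply/seteqP; split=> s /= H j jn.
    by case: j jn => //= j jn; apply/mem_set/H.
  exact/set_mem/(H j.+1).
exact: (measurable_backward_rank j.+1 A).
Qed.

End Renewal.

(** * Renewal times and blocks *)

Lemma next_ex (s : permN) a : (exists2 m, (a < m)%N & renews s m) ->
  exists m, (a < m)%N && `[< renews s m >].
Proof. by case=> m am Rm; exists m; rewrite am; apply/asboolP. Qed.

(** Junk value: [a.+1] when there is no renewal after [a]; as it is compatible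
    with shifts, [next_renewal_shiftp] holds unconditionally. *)
Definition next_renewal (s : permN) (a : nat) : nat :=
  if pselect (exists2 m, (a < m)%N & renews s m) is left e
  then ex_minn (next_ex e) else a.+1.

(** The graph in terms of [renews] and [no_renewal], from which measurability is read off; the
    second case is the junk value. *)
Lemma next_renewalP (s : permN) a m : next_renewal s a = m <->
  [/\ (a < m)%N, renews s m & no_renewal a m.-1 s] \/
  m = a.+1 /\ forall n, no_renewal a n s.
Proof.
rewrite /next_renewal; case: pselect => [e|ne]; last first.
  split=> [<-|]; last first.
    by case=> [[am Rm _]|[-> //]]; exfalso; apply: ne; exists m.
  by right; split=> // n i /andP[ai _] Ri; apply: ne; exists i.
case: ex_minnP => k /andP[ak /asboolP Rk] mink; split=> [<-|].
  left; split=> // i /andP[ai ik] Ri.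
  have := mink i; rewrite ai => /(_ (asboolT Ri)); lia.
case=> [[am Rm Hm]|[_ H]]; last by exfalso; apply: (H k k) Rk; rewrite ak leqnn.
apply/eqP; rewrite eqn_leq mink ?am ?(asboolT Rm)//=.
by rewrite leqNgt; apply/negP => km; apply: (Hm k) Rk; rewrite ak; lia.
Qed.

Lemma next_renewal_gt s a : (a < next_renewal s a)%N.
Proof. by have [[//]|[-> _]] := proj1 (next_renewalP s a _) erefl. Qed.

Lemma next_renewal_renews s a : infinitely_renewing s -> renews s (next_renewal s a).
Proof.
move=> H; have [[//]|[_ N]] := proj1 (next_renewalP s a _) erefl.
by have [i ai Ri] := H a; exfalso; apply: (N i i) Ri; rewrite ai leqnn.
Qed.

Lemma next_renewal_min s a i : (a < i < next_renewal s a)%N -> ~ renews s i.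
Proof.
move=> /andP[ai ib] Ri; have [[_ _ H]|[_ H]] := proj1 (next_renewalP s a _) erefl.
  by apply: (H i) Ri; lia.
by apply: (H i i) Ri; rewrite ai leqnn.
Qed.

Lemma next_renewal_shiftp m (s : permN) a : renews s m ->
  next_renewal s (m + a) = (m + next_renewal (shiftp m s) a)%N.
Proof.
move=> R; apply/next_renewalP.
have [[ab Rb H]|[-> H]] := proj1 (next_renewalP (shiftp m s) a _) erefl; [left|right].
  split; first by rewrite ltn_add2l.
    exact/(shiftp_renews _ R).
  have -> : (m + next_renewal (shiftp m s) a).-1 =
      (m + (next_renewal (shiftp m s) a).-1)%N by lia.
  exact/shiftp_no_renewal.
split; first by rewrite addnS.
move=> n; have [mn|nm] := leqP m n; last by move=> i; lia.
by rewrite -(subnKC mn); apply/(shiftp_no_renewal _ _ R).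
Qed.

Definition renewal_time (k : nat) (s : permN) : nat := iter k (next_renewal s) 0%N.

Arguments renewal_time : simpl never.

Lemma renewal_timeS k s : renewal_time k.+1 s = next_renewal s (renewal_time k s).
Proof. by []. Qed.

Lemma renews_renewal_time k s : infinitely_renewing s -> renews s (renewal_time k s).
Proof.
by move=> H; case: k => [|k]; [exact: renews0 | exact: next_renewal_renews].
Qed.

(** The definition adds the last period; this recursion peels off the first, which is what
    regeneration acts on. *)
Lemma renewal_time_shiftp k s : infinitely_renewing s ->
  renewal_time k.+1 s =
  (renewal_time 1 s + renewal_time k (shiftp (renewal_time 1 s) s))%N.
Proof.
move=> H; have R := renews_renewal_time 1 H; set m := renewal_time 1 s.
elim: k => [|k IHk]; first by rewrite addn0.
by rewrite renewal_timeS IHk next_renewal_shiftp.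
Qed.

Lemma renewal_time_exhausts s m : infinitely_renewing s -> (0 < m)%N -> renews s m ->
  exists2 j, (0 < j)%N & m = renewal_time j s.
Proof.
move=> H m0 Rm.
have lek k : (k <= renewal_time k s)%N.
  by elim: k => // k IHk; apply: leq_ltn_trans IHk (next_renewal_gt _ _).
have ex : exists k, (m <= renewal_time k s)%N by exists m.
case: (ex_minnP ex) => -[|k] mk mink; first by move: mk; rewrite leqNgt m0.
exists k.+1 => //; apply/eqP; rewrite eqn_leq mk leqNgt; apply/negP => lt.
apply: (@next_renewal_min s (renewal_time k s) m) Rm.
by rewrite lt andbT ltnNge; apply/negP => /mink; rewrite ltnn.
Qed.

Lemma measurable_next_renewal a m : measurable [set s | next_renewal s a = m].
Proof.
rewrite (_ : [set s | _] =
  ([set _ | (a < m)%N] `&` ([set s | renews s m] `&` no_renewal a m.-1)) `|`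
  ([set _ | m = a.+1] `&` \bigcap_n no_renewal a n)).
  apply: measurableU; apply: measurableI.
  - by have [am|am] := ltnP a m;
      [rewrite (_ : mkset _ = setT) | rewrite (_ : mkset _ = set0)] => //;
      apply/seteqP; split.
  - by apply: measurableI; [exact: measurable_renews|exact: measurable_no_renewal].
  - by have [am|am] := eqVneq m a.+1;
      [rewrite (_ : mkset _ = setT) | rewrite (_ : mkset _ = set0)] => //;
      apply/seteqP; split=> // s /= /eqP; rewrite (negbTE am).
  - by apply: bigcap_measurableType => n _; exact: measurable_no_renewal.
apply/seteqP; split=> s.
  by move/next_renewalP => [[? ? ?]|[? H]]; [left|right; split=> // n _; exact: H].
move=> H; apply/next_renewalP.
by case: H => [[? [? ?]]|[? H]]; [left|right; split=> // n; exact: (H n I)].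
Qed.

Lemma measurable_renewal_time k (A : set nat) :
  measurable (renewal_time k @^-1` A).
Proof.
apply: (@measurable_preimage_count _ permN nat (renewal_time k)).
elim: k => [|k IHk] m.
  have [->|m0] := eqVneq m 0%N.
    by rewrite (_ : _ @^-1` _ = setT)//; apply/seteqP; split.
  rewrite (_ : _ @^-1` _ = set0)//; apply/seteqP; split=> // s /= e.
  by rewrite -e in m0.
rewrite (_ : _ @^-1` _ = \bigcup_a (renewal_time k @^-1` [set a] `&`
    [set s | next_renewal s a = m])).
  apply: bigcup_measurable => a _; apply: measurableI; first exact: IHk.
  exact: measurable_next_renewal.
apply/seteqP; split=> s /=; first by exists (renewal_time k s).
by move=> [a _ [/= <-]].
Qed.

Definition block (k : nat) (s : permN) : seq nat :=
  red_block s (renewal_time k s) (renewal_time k.+1 s).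

Lemma size_block k s : size (block k s) = (renewal_time k.+1 s - renewal_time k s)%N.
Proof. by rewrite size_map size_iota. Qed.

Lemma eq_red_block (s s' : permN) a b : (forall i, (i < b)%N -> s i = s' i) ->
  red_block s a b = red_block s' a b.
Proof.
move=> e; apply/eq_in_map => i; rewrite mem_iota add0n /= => ib.
by rewrite e//; lia.
Qed.

Lemma measurable_block k (A : set (seq nat)) : measurable (block k @^-1` A).
Proof.
apply: (@measurable_preimage_count _ permN (seq nat) (block k)) => w.
rewrite (_ : _ @^-1` _ = \bigcup_a \bigcup_b (renewal_time k @^-1` [set a] `&`
    (renewal_time k.+1 @^-1` [set b] `&` [set s | red_block s a b = w]))).
  apply: bigcup_measurable => a _; apply: bigcup_measurable => b _.
  apply: measurableI; first exact: measurable_renewal_time.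
  apply: measurableI; first exact: measurable_renewal_time.
  apply: (@measurable_local b) => s s' e /= <-.
  by apply: eq_red_block => i ib; rewrite e.
apply/seteqP; split=> s /=.
  by move=> e; exists (renewal_time k s) => //; exists (renewal_time k.+1 s).
by move=> [a _ [b _ [/= <- [/= <-]]]].
Qed.

(** A local substitute for [block 0 s = w], which is not local because of the junk value of
    [next_renewal]. The bound on the size excludes the empty word, for which the trivial renewal at
    0 would count. *)
Definition first_block (w : seq nat) : set permN :=
  [set s | [/\ (0 < size w)%N, first_renewal 1 (size w) s
             & red_block s 0 (size w) = w]].

Lemma local_first_block w : local (size w) (first_block w).
Proof.
move=> s s' e [w0 F E]; split=> //; first exact: local_first_renewal e F.
by rewrite -(eq_red_block 0 e).
Qed.

Fixpoint first_blocks (ws : seq (seq nat)) : set permN :=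
  if ws is w :: ws' then first_block w `&` shiftp (size w) @^-1` first_blocks ws'
  else setT.

Lemma first_block_renews w s : first_block w s -> renews s (size w).
Proof. by case=> _ []. Qed.

Lemma local_first_blocks ws : local (sumn (map size ws)) (first_blocks ws).
Proof.
elim: ws => [|w ws IHws] //=; apply: local_shiftp => //.
- exact: local_first_block.
- exact: first_block_renews.
Qed.

Lemma first_blockP w s : infinitely_renewing s ->
  first_block w s <-> block 0 s = w.
Proof.
move=> H; have R := renews_renewal_time 1 H.
split=> [[w0 [Rw Hw] E]|<-].
  have e1 : renewal_time 1 s = size w.
    apply/next_renewalP; left; split=> // i /andP[i0 iw]; apply: Hw; lia.
  by rewrite /block e1.
have sz : size (block 0 s) = renewal_time 1 s by rewrite size_block subn0.
split; rewrite sz//; first exact: next_renewal_gt.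
split=> // i /andP[i0 i1]; apply: (@next_renewal_min s 0); by rewrite i0.
Qed.

Lemma first_blocksP ws s : infinitely_renewing s ->
  first_blocks ws s <-> [seq block k s | k <- iota 0 (size ws)] = ws.
Proof.
elim: ws s => [|w ws IHws] s H //.
have S1 : forall s', infinitely_renewing s' ->
    [seq block k s' | k <- iota 1 (size ws)] =
    [seq block k (shiftp (renewal_time 1 s') s') | k <- iota 0 (size ws)].
  move=> s' H'; have R := renews_renewal_time 1 H'.
  have -> : iota 1 (size ws) = map (addn 1) (iota 0 (size ws)) by rewrite -iotaDl.
  rewrite -map_comp; apply: eq_map => k /=.
  by rewrite add1n /block shiftp_red_block// -!renewal_time_shiftp.
rewrite /= S1//; split.
  move=> [Fw]; rewrite /= => Fws.
  have e := proj1 (first_blockP w H) Fw.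
  have e1 : renewal_time 1 s = size w by rewrite -e size_block subn0.
  rewrite e e1; congr cons; apply/IHws => //.
  by apply: shiftp_infinitely_renewing => //; exact: first_block_renews.
move=> [e]; have e1 : renewal_time 1 s = size w by rewrite -e size_block subn0.
rewrite e1 => E; have Fw := proj2 (first_blockP w H) e.
split=> //; apply/IHws => //.
by apply: shiftp_infinitely_renewing => //; exact: first_block_renews.
Qed.

Lemma iid_comp d d' d'' (T : measurableType d) (T' : measurableType d')
    (T'' : measurableType d'') (R : realType) (P : probability T R)
    (X : nat -> T -> T') (f : T' -> T'') :
  (forall A, measurable A -> measurable (f @^-1` A)) ->
  iid P X -> iid P (fun k t => f (X k t)).
Proof.
move=> mf [indX eqX]; split=> [J A mA|i j A mA].
  by have := indX J (fun i => f @^-1` A i) (fun i => mf _ (mA i)).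
by have := eqX i j _ (mf _ mA).
Qed.

(** X is the sum of the indicators of n < X, integrated term by term. *)
Lemma expectation_nat_tail d (T : measurableType d) (R : realType)
    (P : probability T R) (X : T -> nat) :
  (forall A : set nat, measurable (X @^-1` A)) ->
  ('E_P[fun t => (X t)%:R] =
  \sum_(n <oo) P (X @^-1` [set k | (n < k)%N]))%E.
Proof.
move=> mX; rewrite unlock.
pose A n := X @^-1` [set k | (n < k)%N].
transitivity (\int[P]_t (\sum_(n <oo) (\1_(A n) t)%:E))%E.
  apply: eq_integral => t _.
  rewrite (nneseries_split 0 (X t)); last by move=> k _; rewrite lee_fin.
  rewrite add0n [X in (_ + X)%E]eseries0 ?adde0; last first.
    by move=> k kX _; rewrite indicE memNset// /A /= ltnNge kX.
  rewrite big_mkord (eq_bigr (fun=> 1%E)).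
    by rewrite sumEFin sumr_const card_ord.
  by move=> k _; rewrite indicE mem_set// /A /=.
rewrite integral_nneseries//.
- by apply: eq_eseriesr => n _; rewrite integral_indic ?setIT//; exact: mX.
- move=> n; apply/measurable_EFinP; apply: measurable_indic; exact: mX.
Qed.

HB.instance Definition _ k := isMeasurableFun.Build _ _ permN nat (renewal_time k)
  (fun (_ : measurable setT) A (_ : measurable A) =>
     measurableI _ _ measurableT (measurable_renewal_time k A)).

Section RenewalStructure.
Context {R : realType} (P : probability permN R) (pr : nat -> R).
Hypothesis Hc : code_law P pr.
Variable U : R.
Hypothesis U0 : 0 < U.
Hypothesis HU : forall m, U <= renewal_prob P m.

Let mI := measurable_infinitely_renewing.
Let I1 := mass_infinitely_renewing Hc U0 HU.

Lemma measurable_first_block w : measurable (first_block w).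
Proof. exact: measurable_local (@local_first_block w). Qed.

Lemma measurable_first_blocks ws : measurable (first_blocks ws).
Proof. exact: measurable_local (@local_first_blocks ws). Qed.

Lemma mass_first_blocks ws :
  mass P (first_blocks ws) = \prod_(w <- ws) mass P (first_block w).
Proof.
elim: ws => [|w ws IHws]; first by rewrite big_nil mass_setT.
rewrite big_cons -IHws; apply: (mass_regeneration Hc).
- exact: local_first_block.
- exact: first_block_renews.
- exact: local_first_blocks.
Qed.

Lemma mass_blocks n (B : nat -> set (seq nat)) :
  mass P [set s | forall k, (k < n)%N -> B k (block k s)] =
  \prod_(k < n) mass P (block 0 @^-1` B k).
Proof.
apply: (mass_product_of_words (q := fun w => mass P (first_block w))).
- by move=> i a; exact: measurable_block.
- move=> w; apply: (mass_ae_eq mI I1) => //.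
  + exact: measurable_block.
  + exact: measurable_first_block.
  + by move=> s Is; apply: iff_sym; exact: first_blockP.
- move=> ws; rewrite -mass_first_blocks; apply: (mass_ae_eq mI I1).
  + apply: (@measurable_prefix _ _ _ block (size ws)) => i a.
    exact: measurable_block.
  + exact: measurable_first_blocks.
  + by move=> s Is; apply: iff_sym; exact: first_blocksP.
Qed.

Lemma iid_block : iid P (fun k s => block k s).
Proof.
have [ind eqd] := @independent_of_product _ _ R P _ (seq nat) (fun k s => block k s)
  (fun k A => mass P (block 0 @^-1` A)) (fun n B _ => mass_blocks n B)
  (fun i A _ => measurable_block i A).
by split=> // i j A mA; rewrite !eqd.
Qed.

Lemma strictly_regenerative_renewal_time :
  strictly_regenerative P (fun k => renewal_time k : {RV P >-> nat}).
Proof.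
split.
- exists (~` infinitely_renewing); split.
  + exact: measurableC.
  + exact: etrans (infinitely_renewing_ae Hc U0 HU) erefl.
  + apply: subsetC => s Is; split => //.
    * by move=> k; exact: next_renewal_gt.
    * by move=> j _; exact: renews_renewal_time.
    * move=> m m0 Hm Rm.
      by have [j j0 mj] := renewal_time_exhausts Is m0 Rm; exact: (Hm j j0 mj).
(* The increments of the renewal times are the sizes of the blocks. *)
- have := iid_comp (f := size) (T'' := nat) _ iid_block.
  rewrite (_ : (fun k s => size (block k s)) =
    (fun k s => renewal_time k.+1 s - renewal_time k s)%N); first by apply.
  by apply/funext => k; apply/funext => s; rewrite size_block.
- exact: iid_block.
Qed.

Lemma positive_recurrent_renewal_time :
  positive_recurrent P (fun k => renewal_time k : {RV P >-> nat}).
Proof.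
rewrite /positive_recurrent expectation_nat_tail; last first.
  exact: measurable_renewal_time.
apply: (@le_lt_trans _ _ (U^-1)%:E); last exact: ltry.
apply: lime_le; first by apply: is_cvg_nneseries => n _ _; exact: measure_ge0.
apply: nearW => n; rewrite big_mkord.
rewrite (eq_bigr (fun k : 'I_n => (no_renewal_prob P k)%:E)).
  by rewrite sumEFin lee_fin (sum_no_renewal_prob_le Hc U0 HU).
move=> k _; rewrite massE; last exact: measurable_renewal_time.
congr EFin; apply: (mass_ae_eq mI I1).
- exact: measurable_renewal_time.
- exact: measurable_no_renewal.
move=> s Is /=; split=> [kT i /andP[i0 ik]|Hk].
  by apply: (@next_renewal_min s 0); rewrite i0 (leq_ltn_trans ik).
rewrite ltnNge; apply/negP => Tk.
apply: (Hk (renewal_time 1 s)); last exact: renews_renewal_time.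
by rewrite Tk next_renewal_gt.
Qed.

End RenewalStructure.

(** * Shifted laws *)

(** The values of an increasing [psi] below [psi n] are those at 0, ..., n - 1. This identifies the
    k-th sample with the k-th code. *)
Lemma count_range_homo (psi : nat -> nat) (Q : pred nat) n :
  {homo psi : a b / (a < b)%N} -> (forall v, Q v <-> range psi v) ->
  count Q (iota 0 (psi n)) = n.
Proof.
move=> psi_homo QE; have psi_mono := leqW_mono (leq_mono psi_homo).
rewrite -size_filter -[RHS](size_iota 0) -[RHS](size_map psi).
apply/perm_size/uniq_perm.
- by rewrite filter_uniq ?iota_uniq.
- by rewrite map_inj_uniq ?iota_uniq//; exact: inc_inj (leq_mono psi_homo).
move=> v; rewrite mem_filter mem_iota add0n leq0n/=; apply/andP/mapP.
  move=> [/QE[y _ <-]]; rewrite psi_mono => yn.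
  by exists y; rewrite ?mem_iota.
move=> [y]; rewrite mem_iota add0n leq0n/= => yn ->.
by split; [apply/QE; exists y|rewrite psi_mono].
Qed.

Lemma notin_prefixP (s : permN) k v :
  v \notin map s (iota 0 k) <-> (~` (s @` `I_k)) v.
Proof.
split=> [/negP nv [i /= ik e]|nv].
  by apply: nv; apply/mapP; exists i; rewrite ?mem_iota.
by apply/negP => /mapP[i]; rewrite mem_iota add0n leq0n/= => ik e; apply: nv; exists i.
Qed.

Lemma shifted_code x (s : permN) : shifted x s -> forall k, code s k = x k.
Proof.
move=> H k; have [psi [psi_homo psi_range e]] := H k.
rewrite codeE e; apply: count_range_homo => // v.
by rewrite psi_range; exact: notin_prefixP.
Qed.

(** The enumerations are built recursively: the next one is the current one made to skip the index
    [code s k] of the letter just used. *)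
Lemma code_shifted (s : permN) : shifted (code s) s.
Proof.
have key k psi : {homo psi : a b / (a < b)%N} -> range psi = ~` (s @` `I_k) ->
    s k = psi (code s k).
  move=> psi_homo psi_range.
  have : (range psi) (s k).
    by rewrite psi_range; apply/notin_prefixP; rewrite mem_prefix pos_perm ltnn.
  move=> [y _ e]; rewrite -e; congr psi; rewrite codeE -e.
  rewrite (@count_range_homo psi)// => v.
  by rewrite psi_range; exact: notin_prefixP.
suff H k : exists psi : nat -> nat,
    {homo psi : a b / (a < b)%N} /\ range psi = ~` (s @` `I_k).
  by move=> k; have [psi [? ?]] := H k; exists psi; split=> //; exact: key.
elim: k => [|k [psi [psi_homo psi_range]]].
  have -> : s @` `I_0 = set0 by apply/seteqP; split=> // v [].
  exists id; split=> //; rewrite setC0.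
  by apply/seteqP; split=> // v _; exists v.
have sk := key k psi psi_homo psi_range.
have psi_inj := inc_inj (leq_mono psi_homo).
(* [bump c] enumerates the complement of [c]. *)
exists (psi \o bump (code s k)); split.
  move=> a b ab; apply: psi_homo; rewrite /bump; lia.
apply/seteqP; split=> v.
  move=> [y _ <-] /= [i]; rewrite /= ltnS leq_eqVlt => /predU1P[->|ik].
    by rewrite sk => /psi_inj /eqP; rewrite (negbTE (neq_bump _ _)).
  move=> e; have : (range psi) (psi (bump (code s k) y)) by exists (bump (code s k) y).
  by rewrite psi_range; apply; exists i.
move=> nv; have : (range psi) v.
  by rewrite psi_range => -[i /= ik e]; apply: nv; exists i => //=; exact: ltnW.
move=> [y _ e]; have yc : y != code s k.
  apply/negP => /eqP yc; apply: nv; exists k => //=.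
  by rewrite sk -yc.
by exists (unbump (code s k) y) => //=; rewrite unbumpK.
Qed.

Section ShiftedLaw.
Context {R : realType} (P : probability permN R).

Lemma shifted_law_code_law (p : probability nat R) :
  shifted_law p P -> code_law P (fun i => fine (p [set i])).
Proof.
move=> [d [Om [Pr [X [Pi [indX lawX [N [mN N0 HN]] lawPi]]]]]] n a.
have mA : measurable [set s : permN | forall k, (k < n)%N -> code s k = a k].
  apply: (@measurable_local n) => s s' e H k kn.
  by rewrite -(eq_code e kn) H.
rewrite /mass -lawPi//.
have mN' : measurable (~` N) by exact: measurableC.
have N1 : mass Pr (~` N) = 1 by rewrite mass_setC// /mass N0 subr0.
transitivity (mass Pr [set o | forall k, (k < n)%N -> [set a k] (X k o)]).
  apply: (mass_ae_eq mN' N1).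
  - exact: measurable_funPTI.
  - rewrite (_ : [set o | _] = \bigcap_(k in `I_n) (X k @^-1` [set a k]))//.
    apply: fin_bigcap_measurable; first exact: finite_II.
    by move=> k _; exact: measurable_funPTI.
  - move=> o No; have sh : shifted (fun k => X k o) (Pi o).
      by apply: contrapT => nsh; apply: No; apply: HN.
    by split=> H k kn; have := H k kn; rewrite /= (shifted_code sh).
transitivity (\prod_(k < n) mass Pr (X k @^-1` [set a k])).
  apply: (@independent_prefix _ _ _ Pr _ _ (fun k => X k : Om -> nat)
    (fun k => [set a k])) => // i; exact: measurable_funPTI.
by apply: eq_bigr => k _; rewrite /mass -(lawX k).
Qed.

Definition code_at k (s : permN) := code s k.

HB.instance Definition _ k := isMeasurableFun.Build _ _ permN nat (code_at k)
  (fun (_ : measurable setT) A (_ : measurable A) =>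
     measurableI _ _ measurableT (measurable_code k A)).

HB.instance Definition _ := isMeasurableFun.Build _ _ permN permN (@idfun permN)
  (@measurable_id _ permN setT).

(** [permN] under [P] serves as the sample space, with the codes as samples and the identity as the
    random permutation. *)
Lemma code_law_shifted_law (pr : nat -> R) : code_law P pr ->
  shifted_law (distribution P (code_at 0)) P.
Proof.
move=> Hc.
have q0 w : mass P (code_at 0 @^-1` [set w]) = pr w.
  have := Hc 1 (fun=> w); rewrite big_ord1 => <-; congr mass.
  apply/seteqP; split=> s /=; last exact.
  by move=> e [|//].
have qw ws : mass P [set s | [seq code_at k s | k <- iota 0 (size ws)] = ws] =
    \prod_(w <- ws) pr w.
  rewrite (big_nth 0%N) big_mkord -Hc; congr mass.
  apply/seteqP; split=> s /=; first by move/seq_code_eq => [].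
  by move=> H; apply/seq_code_eq.
have mc k a : measurable (code_at k @^-1` [set a]) by exact: measurable_code.
have [ind eqd] := @independent_of_product _ _ R P _ nat code_at
  (fun k A => mass P (code_at 0 @^-1` A))
  (fun n B _ => mass_product_of_words mc q0 qw n B)
  (fun i A _ => measurable_code i A).
exists _, permN, P, (fun k => code_at k : {RV P >-> nat}),
  (@idfun permN : {RV P >-> permN}).
split=> //.
- move=> k A mA; rewrite /distribution/= /pushforward eqd// massE//.
- by apply: aeW => s; exact: code_shifted.
Qed.

End ShiftedLaw.

(** * Finite mean *)

(** Factor by factor: 1/f = 1 + (1 - f)/f <= exp((1 - f)/c). *)
Lemma expR_prod_ge (R : realType) (f : nat -> R) (c : R) m : 0 < c ->
  (forall j, c <= f j <= 1) ->
  expR (- ((\sum_(j < m) (1 - f j)) / c)) <= \prod_(j < m) f j.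
Proof.
move=> c0 Hf; elim: m => [|m IHm]; first by rewrite !big_ord0 mul0r oppr0 expR0.
have /andP[fc f1] := Hf m; have f0 : 0 < f m by exact: lt_le_trans fc.
rewrite !big_ord_recr/= mulrDl opprD expRD; apply: ler_pM; rewrite ?expR_ge0//.
rewrite expRN -[leRHS]invrK lef_pV2 ?posrE ?invr_gt0 ?expR_gt0//.
apply: le_trans (expR_ge1Dx _).
have -> : (f m)^-1 = 1 + (1 - f m) / f m.
  by rewrite mulrBl mul1r mulfV ?gt_eqF// addrC subrK.
rewrite lerD2l; apply: ler_wpM2l; first by rewrite subr_ge0.
by rewrite lef_pV2 ?posrE.
Qed.

(** With x the new factor and s the old sum, the induction step is x (2 + s - x) <= 1 + s, that is
    (1 - x)(1 + s - x) >= 0. *)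
Lemma prod_mul_sum_le1 (R : realType) (f : nat -> R) m :
  (forall j, 0 <= f j <= 1) ->
  (\prod_(j < m) f j) * (1 + \sum_(j < m) (1 - f j)) <= 1.
Proof.
move=> Hf; elim: m => [|m IHm]; first by rewrite !big_ord0 addr0 mulr1.
rewrite !big_ord_recr/= -mulrA; apply: le_trans IHm.
apply: ler_wpM2l; first by apply: prodr_ge0 => i _; have /andP[] := Hf i.
have /andP[] := Hf m.
have : 0 <= \sum_(j < m) (1 - f j).
  by apply: sumr_ge0 => i _; rewrite subr_ge0; have /andP[] := Hf i.
set s := \sum_(j < m) _; set x := f m; nra.
Qed.

Section Series.
Context {R : realType}.
Variable pr : nat -> R.
Hypothesis pr0 : forall i, 0 <= pr i.
Local Notation F n := (\sum_(i < n) pr i).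
Hypothesis F1 : forall n, F n <= 1.

Lemma partial_sum_le m n : (m <= n)%N -> F m <= F n.
Proof.
move=> mn; rewrite -(subnKC mn) big_split_ord/= lerDl.
by apply: sumr_ge0 => i _; exact: pr0.
Qed.

(** Summation by parts: [pr k] occurs in F N - F i for the k + 1 indices i <= k. *)
Lemma sum_tail_moment N :
  \sum_(k < N) k.+1%:R * pr k = \sum_(i < N) (F N - F i).
Proof.
elim: N => [|N IHN]; first by rewrite !big_ord0.
rewrite big_ord_recr/= {}IHN [RHS]big_ord_recr/=.
have -> : \sum_(i < N) (F N.+1 - F i) = \sum_(i < N) (F N - F i) + N%:R * pr N.
  have -> : N%:R * pr N = \sum_(i < N) pr N.
    by rewrite sumr_const card_ord mulr_natl.
  rewrite -big_split/=.
  by apply: eq_bigr => i _; rewrite big_ord_recr/= addrAC.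
set A := \sum_(i < N) (F N - F i).
by rewrite big_ord_recr/= (addrAC (F N)) subrr add0r -natr1 mulrDl mul1r addrA.
Qed.

Lemma sum_tail_le (S : R) :
  (forall N, \sum_(k < N) k.+1%:R * pr k <= S) -> (F n @[n --> \oo] --> (1 : R)) ->
  forall N, \sum_(i < N) (1 - F i) <= S.
Proof.
move=> HS cvgF N.
have H M : (N <= M)%N -> \sum_(i < N) (F M - F i) <= S.
  move=> NM; apply: le_trans (HS M); rewrite sum_tail_moment.
  rewrite -[in leRHS](subnKC NM) big_split_ord/=.
  rewrite (subnKC NM) lerDl; apply: sumr_ge0 => i _.
  by rewrite subr_ge0 partial_sum_le//; have := ltn_ord i; lia.
have cvgS : \sum_(i < N) (F M - F i) @[M --> \oo] --> \sum_(i < N) (1 - F i).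
  clear H; elim: N => [|N IHN].
    by under eq_fun do rewrite big_ord0; rewrite big_ord0; exact: cvg_cst.
  under eq_fun do rewrite big_ord_recr/=; rewrite big_ord_recr/=.
  by apply: cvgD => //; apply: cvgB; [exact: cvgF|exact: cvg_cst].
rewrite -(cvg_lim _ cvgS)//; apply: limr_le.
  by apply/cvg_ex; exists (\sum_(i < N) (1 - F i)).
by exists N => // M /= NM; exact: H.
Qed.

Lemma prod_partial_sum_ge (S : R) : 0 < pr 0 ->
  (forall N, \sum_(i < N) (1 - F i) <= S) ->
  forall m, expR (- (S / pr 0)) <= \prod_(j < m) F j.+1.
Proof.
move=> p0 HS m.
have Fp j : pr 0 <= F j.+1.
  by have := @partial_sum_le 1 j.+1 isT; rewrite big_ord1.
have Hf j : pr 0 <= F j.+1 <= 1 by rewrite Fp F1.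
apply: le_trans (expR_prod_ge m p0 Hf).
rewrite ler_expR lerN2 ler_pM2r ?invr_gt0//.
(* The sum of tails has the extra term 1 - F 0 = 1, while the product starts with F 1. *)
apply: le_trans (HS m.+1); rewrite big_ord_recl/= big_ord0 lerDr subr0.
exact: ler01.
Qed.

Lemma sum_tail_of_prod_le (U : R) : 0 < U ->
  (forall m, U <= \prod_(j < m) F j.+1) ->
  forall N, \sum_(k < N) k.+1%:R * pr k <= 1 + U^-1.
Proof.
move=> U0 HU N.
have F0 n : 0 <= F n by apply: sumr_ge0 => i _; exact: pr0.
have H m : (\prod_(j < m) F j.+1) * (1 + \sum_(j < m) (1 - F j.+1)) <= 1.
  by apply: (@prod_mul_sum_le1 _ (fun j => F j.+1)) => j; rewrite F0 F1.
rewrite sum_tail_moment; apply: le_trans (_ : \sum_(i < N.+1) (1 - F i) <= _).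
  rewrite big_ord_recr/=; apply: ler_wpDr; first by rewrite subr_ge0 F1.
  by apply: ler_sum => i _; rewrite lerD2r F1.
(* The tail at 0 accounts for the 1 in the bound; the others are bounded through the product. *)
rewrite big_ord_recl/= big_ord0 subr0 lerD2l.
rewrite -(ler_pM2l U0) mulfV ?gt_eqF//.
have := H N; set s := \sum_(i < N) _ => HN.
have s0 : 0 <= s by apply: sumr_ge0 => i _; rewrite subr_ge0 F1.
apply: le_trans HN; apply: le_trans (_ : U * (1 + s) <= _).
  by apply: ler_wpM2l; [exact: ltW|rewrite lerDr].
by apply: ler_wpM2r => //; rewrite addr_ge0.
Qed.

End Series.

Section NatLaw.
Context {R : realType} (p : probability nat R).

Lemma mass_prefix n : mass p `I_n = \sum_(i < n) mass p [set i : nat].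
Proof.
apply: (@mass_sum _ _ _ p _ _ (fun i : 'I_n => [set val i])) => //.
  by move=> i j k -> /= /val_inj.
apply/seteqP; split=> k /=; first by move=> kn; exists (Ordinal kn).
by move=> [i _ ->] /=.
Qed.

Lemma mass_prefix_cvg : mass p `I_n @[n --> \oo] --> (1 : R).
Proof.
apply: mass_cvg_up => //.
  by move=> m n mn; apply/subsetPset => k /= /leq_trans; apply.
by apply/seteqP; split=> // k _; exists k.+1 => /=.
Qed.

End NatLaw.

Lemma shifted_law_conditions (R : realType) (P : probability permN R)
    (p : probability nat R) :
  (forall j : nat, 0 < p [set j])%E ->
  (\sum_(0 <= n <oo) (n.+1%:R)%:E * p [set n] < +oo)%E ->
  shifted_law p P ->
  [/\ independent_seq P (fun k => backward_rank k.+1),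
      (exists T : nat -> {RV P >-> nat},
         strictly_regenerative P T /\ positive_recurrent P T) /\
      (0 < P [set s : permN | renews s 1])%E
    & forall n : nat, (0 < n)%N -> proj_support P n = setT].
Proof.
move=> p_gt0 Sp /shifted_law_code_law Hc.
pose pr i := mass p [set i].
rewrite -/pr in Hc.
have pr_gt0 i : 0 < pr i by rewrite -lte_fin -massE.
have pr_ge0 i : 0 <= pr i by exact: ltW.
have Fle1 n : \sum_(i < n) pr i <= 1.
  by rewrite -mass_prefix mass_le1.
have term_ge0 n : (0 <= (n.+1%:R)%:E * p [set n])%E by rewrite mule_ge0.
set S := (\sum_(0 <= n <oo) _)%E in Sp.
have Sfin : S \is a fin_num.
  by rewrite ge0_fin_numE//; apply: nneseries_ge0 => n _ _.
have HS N : \sum_(k < N) k.+1%:R * pr k <= fine S.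
  rewrite -lee_fin fineK// -sumEFin.
  rewrite (eq_bigr (fun k : 'I_N => (k.+1%:R)%:E * p [set val k])%E); last first.
    by move=> k _; rewrite EFinM -massE.
  rewrite -(big_mkord predT (fun k => (k.+1%:R)%:E * p [set k])%E).
  exact: nneseries_lim_ge.
have cvgF : \sum_(i < n) pr i @[n --> \oo] --> (1 : R).
  under eq_fun do rewrite -mass_prefix.
  exact: mass_prefix_cvg.
have HU m : expR (- (fine S / pr 0)) <= renewal_prob P m.
  rewrite (renewal_prob_prod Hc); apply: prod_partial_sum_ge => //.
  exact: sum_tail_le.
have U0 : 0 < expR (- (fine S / pr 0)) by exact: expR_gt0.
split.
- exact (independent_backward_rank Hc U0 HU).
- split.
    exists (fun k => renewal_time k : {RV P >-> nat}); split.
      exact (strictly_regenerative_renewal_time Hc U0 HU).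
    exact (positive_recurrent_renewal_time Hc U0 HU).
  rewrite massE; last exact: measurable_renews.
  by rewrite lte_fin (lt_le_trans U0)// HU.
move=> n _; apply/seteqP; split=> // t _ /=.
have mt := measurable_proj_perm t.
rewrite /proj_support/= massE// lte_fin.
(* It suffices that [s] starts with the word t, an event whose mass is a product of positive
   weights. *)
apply: lt_le_trans (_ : \prod_(k < n) pr (code (ext t) k) <= _).
  by apply: prodr_gt0 => k _.
rewrite -(mass_word Hc); apply: mass_le => //.
  by apply: (@measurable_local n) => s s' e H k kn; rewrite -e// H.
move=> s /= es; apply/proj_perm_eq => j jn; apply: eq_backward_rank => v vj.
apply/esym; apply: (@eq_pos_renews _ _ n) => //.
- by move=> k kn; rewrite es.
- exact: renews_ext.
- exact: leq_ltn_trans jn.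
Qed.

(** * Backward ranks of regenerative permutations *)

Lemma shiftp_backward_rank m (s : permN) j : renews s m ->
  backward_rank j (shiftp m s) = backward_rank (m + j) s.
Proof. by move=> R; rewrite !backward_rank_pos shiftp_code// shiftp_pos. Qed.

(** The backward rank as a function of a word, since regeneration is stated for blocks in one-line
    notation. *)
Definition word_rank (w : seq nat) (j : nat) : nat :=
  count (fun i => (index j w < index i w)%N) (iota 0 j).

Lemma backward_rank_word (s : permN) c j : renews s c -> (j < c)%N ->
  backward_rank j s = word_rank (red_block s 0 c) j.
Proof.
move=> R jc; rewrite /backward_rank (card_count_iota j (fun i => (pos s j < pos s i)%N)).
have E v : (v < c)%N -> index v (red_block s 0 c) = pos s v.
  move=> vc; rewrite /red_block subn0 (eq_map (g := s)); last first.
    by move=> i; rewrite add0n subn0.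
  rewrite -[in LHS](pos_can s v) index_map; last exact: permN_inj.
  have := @index_uniq _ 0%N (pos s v) (iota 0 c).
  rewrite size_iota (renews_pos R) nth_iota ?(renews_pos R)// add0n.
  by apply => //; exact: iota_uniq.
apply: eq_in_count => i; rewrite mem_iota add0n leq0n/= => ij.
by rewrite !E//; apply: ltn_trans jc.
Qed.

(** Undoes the reduction of consecutive blocks, each being raised by the total size of the earlier
    ones. *)
Fixpoint cat_blocks (ws : seq (seq nat)) : seq nat :=
  if ws is w :: ws' then w ++ map (addn (size w)) (cat_blocks ws') else [::].

Lemma red_block_cat (s : permN) a b c : (a <= b <= c)%N -> renews s b ->
  red_block s a c = red_block s a b ++ map (addn (b - a)) (red_block s b c).
Proof.
move=> /andP[ab bc] R.
have -> : (red_block s a c = [seq s (a + i) - a | i <- iota 0 (b - a)] ++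
    [seq s (a + i) - a | i <- iota (b - a) (c - b)])%N.
  rewrite /red_block -map_cat; congr map.
  by rewrite -[X in _ ++ iota X _]add0n -iotaD; congr iota; lia.
congr (_ ++ _); rewrite -[X in iota X _]addn0 iotaDl /red_block -!map_comp.
apply: eq_map => i /=.
have := renews_ge R (leq_addr i b).
rewrite addnA (_ : a + (b - a) = b)%N; lia.
Qed.

Lemma iid_prefix d (T : measurableType d) (R : realType) (P : probability T R)
    (T' : countType) d' (T'' : measurableType d') 
    (X : nat -> T -> T'') (f : T'' -> T') n :
  (forall A : set T'', measurable A) -> (forall i A, measurable (X i @^-1` A)) ->
  iid P X -> forall (A : set T') (C : set (seq T')),
  mass P [set t | A (f (X 0 t)) /\ C [seq f (X i t) | i <- iota 1 n]] =
  mass P [set t | A (f (X 0 t))] * mass P [set t | C [seq f (X i t) | i <- iota 0 n]].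
Proof.
move=> mT mX [indX eqX] A C.
pose Y i t := f (X i t).
have mY i a : measurable (Y i @^-1` [set a]) by exact: (mX i (f @^-1` [set a])).
have mY1 i a : measurable (Y i.+1 @^-1` [set a]) by exact: (mX i.+1 (f @^-1` [set a])).
have law i (B : set T') : mass P (Y i @^-1` B) = mass P (Y 0 @^-1` B).
  by rewrite /mass (eqX i 0 (f @^-1` B)).
have prefix k (B : nat -> set T') :
    mass P [set t | forall i, (i < k)%N -> B i (Y i t)] =
    \prod_(i < k) mass P (Y 0 @^-1` B i).
  rewrite (@independent_prefix _ _ _ _ _ _ X (fun i => f @^-1` B i))//.
  by apply: eq_bigr => i _; exact: law.
have mapE (g : nat -> T') k w (a0 : T') : [seq g i | i <- iota 0 k] = w <->
    size w = k /\ forall i, (i < k)%N -> g i = nth a0 w i.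
  split=> [<-|[sw H]].
    rewrite size_map size_iota; split=> // i ik.
    by rewrite (nth_map 0%N) ?size_iota// nth_iota.
  apply: (@eq_from_nth _ a0); rewrite size_map size_iota// => i ik.
  by rewrite (nth_map 0%N) ?size_iota// nth_iota// H.
have S t : [seq f (X i t) | i <- iota 1 n] = [seq Y i.+1 t | i <- iota 0 n].
  by rewrite -[1%N in LHS](addn0 1) iotaDl -map_comp.
rewrite (_ : [set t | _ /\ _] = Y 0 @^-1` A `&`
    (fun t => [seq Y i.+1 t | i <- iota 0 n]) @^-1` C); last first.
  by apply/seteqP; split=> t /=; rewrite S.
apply: mass_count_prod => //.
- exact: measurable_prefix mY1.
- exact: measurable_prefix mY.
move=> a w; have [sw|nsw] := eqVneq (size w) n; last first.
  have E (g : nat -> T -> T') :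
      (fun t => [seq g i t | i <- iota 0 n]) @^-1` [set w] = set0.
    apply/seteqP; split=> // t /= e.
    by move: nsw; rewrite -e size_map size_iota eqxx.
  by rewrite !E setI0 mass_set0 mulr0.
transitivity (mass P [set t | forall i, (i < n.+1)%N -> [set nth a (a :: w) i] (Y i t)]).
  congr mass; apply/seteqP; split=> t /=.
    move=> [e0 /(mapE _ _ _ a)[_ H]] [|i]//=; rewrite ltnS; exact: H.
  move=> H; split; first exact: (H 0%N).
  by apply/(mapE _ _ _ a); split=> // i ik; exact: (H i.+1).
rewrite (prefix n.+1 (fun i => [set nth a (a :: w) i])) big_ord_recl/=; congr (_ * _).
rewrite -(prefix n (fun i => [set nth a w i])); congr mass; apply/seteqP; split=> t /=.
  by move=> H; apply/(mapE _ _ _ a).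
by case/(mapE _ _ _ a).
Qed.

(** A first letter other than 0 would have all smaller letters to its right, hence maximal rank; and
    if 0 comes first, no other letter has maximal rank. *)
Lemma renews1P (s : permN) :
  renews s 1 <-> forall l, (backward_rank l.+1 s < l.+1)%N.
Proof.
split=> [R l|H].
  have p0 : pos s 0 = 0%N by have := renews_pos R 0; case: (pos s 0).
  rewrite /backward_rank (card_count_iota l.+1 (fun i => (pos s l.+1 < pos s i)%N)) /=.
  rewrite p0 ltn0 add0n ltnS; apply: leq_trans (count_size _ _) _.
  by rewrite size_iota.
apply/renewsP => -[|//] _; rewrite ltnS leqn0; apply/eqP.
case e : (s 0%N) => [//|l]; have := H l; rewrite ltnNge => /negP; case.
rewrite -e /backward_rank pos_perm.
rewrite -[X in (X <= _)%N]card_ord; apply/eq_leq/eq_card => i; rewrite !inE.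
rewrite lt0n; apply/esym/eqP => pi; have := ltn_ord i.
by rewrite -{1}(pos_can s i) pi ltnn.
Qed.

Lemma backward_rank_le j s : (backward_rank j s <= j)%N.
Proof. by rewrite -[X in (_ <= X)%N]card_ord; exact: max_card. Qed.

Lemma exists_backward_rank j i : (i <= j)%N ->
  exists t : 'S_j.+1, backward_rank j (ext t) = i.
Proof.
move=> ij; apply: contrapT => nt.
(* The sum over all [t] of the indicators of [b_j t = i] factors into nonzero
   terms. *)
have := sum_prod_backward_rank j.+1
  (fun j' i' => (if j' == j then (i' == i)%:R else 1) : int).
rewrite big1; last first.
  move=> t _; rewrite big_ord_recr/= eqxx (_ : _ == i = false) ?mulr0//.
  by apply/negP => /eqP e; apply: nt; exists t.
move/esym/eqP; rewrite big_ord_recr/= eqxx mulf_eq0; apply/negP; rewrite negb_or.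
apply/andP; split.
  apply/prodf_neq0 => k _; rewrite ltn_eqF//.
  by rewrite sumr_const card_ord pnatr_eq0.
rewrite (bigD1 (Ordinal (ij : (i < j.+1)%N)))//= eqxx big1 ?addr0//.
by move=> k /eqP ki; case: eqP => // e; case: ki; exact: val_inj.
Qed.

Section Regenerative.
Context {R : realType} (P : probability permN R) (T : nat -> {RV P >-> nat}).
Hypothesis SR : strictly_regenerative P T.

Let block_at k (s : permN) := red_block s (T k s) (T k.+1 s).

Lemma strictly_regenerative_good : exists G : set permN,
  [/\ measurable G, mass P G = 1 &
   forall s, G s -> [/\ T 0 s = 0%N, forall k, (T k s < T k.+1 s)%N,
     forall k, renews s (T k s) &
     forall m, (0 < m)%N -> renews s m -> exists2 j, (0 < j)%N & m = T j s]].
Proof.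
have [[N [mN N0 HN]] _ _] := SR; exists (~` N); split.
- exact: measurableC.
- by rewrite mass_setC// /mass N0 subr0.
move=> s Ns.
have [T0 Tinc Tren Tall] : [/\ T 0 s = 0%N, forall k, (T k s < T k.+1 s)%N,
    forall j, (0 < j)%N -> renews s (T j s)
  & forall m, (0 < m)%N -> (forall j, (0 < j)%N -> m <> T j s) -> ~ renews s m].
  by apply: contrapT => ns; apply: Ns; apply: HN.
split=> // [[|k]|m m0 Rm].
- by rewrite T0; exact: renews0.
- exact: Tren.
apply: contrapT => nj; apply: (Tall m m0) Rm => j j0 mj; apply: nj.
by exists j.
Qed.

Lemma measurable_RV (X : {RV P >-> nat}) (A : set nat) : measurable (X @^-1` A).
Proof. exact: measurable_funPTI. Qed.

Lemma measurable_block_at k (A : set (seq nat)) : measurable (block_at k @^-1` A).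
Proof.
apply: (@measurable_preimage_count _ permN (seq nat) (block_at k)) => w.
rewrite (_ : _ @^-1` _ = \bigcup_a \bigcup_b (T k @^-1` [set a] `&`
    (T k.+1 @^-1` [set b] `&` [set s | red_block s a b = w]))).
  apply: bigcup_measurable => a _; apply: bigcup_measurable => b _.
  apply: measurableI; first exact: measurable_RV.
  apply: measurableI; first exact: measurable_RV.
  apply: (@measurable_local b) => s s' e /= <-.
  by apply: eq_red_block => i ib; rewrite e.
apply/seteqP; split=> s /=.
  by move=> e; exists (T k s) => //; exists (T k.+1 s).
by move=> [a _ [b _ [/= <- [/= <-]]]].
Qed.

(** A renewal at 1 means that block 0 is a single letter. Then rank j + 1 is computed from blocks 1,
    ..., j + 1 as rank j is from blocks 0, ..., j, and these have the same law, independently of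
    block 0. As blocks are nonempty, j + 1 of them cover the letter j. *)
Lemma mass_renews1_backward_rank j (A : set nat) :
  mass P [set s | renews s 1 /\ A (backward_rank j.+1 s)] =
  mass P [set s | renews s 1] * mass P [set s | A (backward_rank j s)].
Proof.
have [G [mG G1 HG]] := strictly_regenerative_good.
pose C := [set ws : seq (seq nat) | A (word_rank (cat_blocks ws) j)].
have CE ws : C ws = A (word_rank (cat_blocks ws) j) by [].
have Tle s : G s -> forall k n, (T k s + n <= T (k + n) s)%N.
  move=> /HG[_ Tinc _ _] k; elim=> [|n IHn]; first by rewrite !addn0.
  by rewrite !addnS; apply: leq_ltn_trans IHn (Tinc _).
have catE s : G s -> forall n k, red_block s (T k s) (T (k + n) s) =
    cat_blocks [seq block_at i s | i <- iota k n].
  move=> Gs; have [_ _ Tren _] := HG s Gs.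
  elim=> [|n IHn] k /=; first by rewrite addn0 /red_block subnn.
  rewrite (@red_block_cat s _ (T k.+1 s)).
  - rewrite -IHn addSnnS /block_at; congr (_ ++ map (addn _) _).
    by rewrite size_map size_iota.
  - have := Tle s Gs k 1; have := Tle s Gs k.+1 n; rewrite addSnnS !addn1; lia.
  - exact: Tren.
have size_block_at s k : size (block_at k s) = (T k.+1 s - T k s)%N.
  by rewrite size_map size_iota.
have R1 s : G s -> renews s 1 <-> size (block_at 0 s) = 1%N.
  move=> Gs; have [T0 _ Tren Tall] := HG s Gs.
  rewrite size_block_at T0 subn0; split=> [Rs|<-//].
  have [[|k] // _ e] := Tall 1%N isT Rs.
  by have := Tle s Gs 1%N k; have := Tle s Gs 0%N 1%N; rewrite T0 !add0n add1n -e; lia.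
have b0 s : G s -> A (backward_rank j s) <->
    C [seq block_at i s | i <- iota 0 j.+1].
  move=> Gs; have [T0 _ Tren _] := HG s Gs.
  rewrite CE -catE// T0 add0n.
  rewrite (backward_rank_word (Tren j.+1))//.
  by have := Tle s Gs 0%N j.+1; rewrite T0 !add0n; lia.
have b1 s : G s -> renews s 1 -> A (backward_rank j.+1 s) <->
    C [seq block_at i s | i <- iota 1 j.+1].
  move=> Gs Rs; have [T0 _ Tren _] := HG s Gs.
  have T1 : T 1 s = 1%N by have := proj1 (R1 s Gs) Rs; rewrite size_block_at T0 subn0.
  rewrite CE -catE// T1 add1n.
  have Tj : (j < (T j.+2 s).-1)%N by have := Tle s Gs 1 j.+1; rewrite T1 !add1n; lia.
  have e : (1 + (T j.+2 s).-1)%N = T j.+2 s by lia.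
  rewrite -add1n -shiftp_backward_rank// (@backward_rank_word _ (T j.+2 s).-1)//.
    by rewrite shiftp_red_block// addn0 e.
  by apply/shiftp_renews => //; rewrite e.
have [_ _ iidb] := SR.
have mT (B : set (seq nat)) : measurable B by [].
have mb k (B : set (seq nat)) := measurable_block_at k B.
have m1 : measurable [set s : permN | renews s 1] by exact: measurable_renews.
have mA i : measurable [set s : permN | A (backward_rank i s)].
  exact: measurable_backward_rank.
have mC k : measurable [set s | C [seq block_at i s | i <- iota k j.+1]].
  have E s : [seq block_at i s | i <- iota k j.+1] =
      [seq block_at (k + i) s | i <- iota 0 j.+1].
    by rewrite -{1}[k]addn0 iotaDl -map_comp.
  rewrite (_ : [set s | _] =
      (fun s => [seq block_at (k + i) s | i <- iota 0 j.+1]) @^-1` C); last first.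
    by apply/funext => s; exact: (congr1 C (E s)).
  apply: measurable_preimage_count.
  apply: (@measurable_prefix _ permN (seq nat) (fun i => block_at (k + i)) j.+1).
  by move=> i a; exact: mb.
have mS : measurable [set s | size (block_at 0 s) = 1%N].
  exact: (mb 0%N [set w | size w = 1%N]).
rewrite (mass_ae_eq mG G1 (B := [set s | size (block_at 0 s) = 1%N /\
    C [seq block_at i s | i <- iota 1 j.+1]])); last 3 first.
- exact: (measurableI _ _ m1 (mA j.+1)).
- exact: (measurableI _ _ mS (mC 1%N)).
- move=> s Gs; split=> -[].
    by move=> Rs As; split; [apply/R1|apply/b1].
  by move=> /(R1 s Gs) Rs Cs; split=> //; apply/b1.
rewrite (mass_ae_eq mG G1 m1 mS R1).
rewrite (mass_ae_eq mG G1 (mA j) (mC 0%N) b0).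
exact: (@iid_prefix _ _ R P _ _ _ block_at id j.+1 mT mb iidb [set w | size w = 1%N] C).
Qed.

Lemma mass_time1_gt n : mass P [set s | (n < T 1 s)%N] = no_renewal_prob P n.
Proof.
have [G [mG G1 HG]] := strictly_regenerative_good.
apply: (mass_ae_eq mG G1).
- exact: (measurable_RV (T 1) [set k | (n < k)%N]).
- exact: measurable_no_renewal.
move=> s /HG[T0 Tinc Tren Tall]; have T1le j : (0 < j)%N -> (T 1 s <= T j s)%N.
  by case: j => // j _; elim: j => // j IHj; apply: ltnW (leq_ltn_trans IHj (Tinc _)).
split=> /= [nT i /andP[i0 ni] Ri|H].
  by have [j /T1le + ij] := Tall i i0 Ri; rewrite -ij; lia.
rewrite ltnNge; apply/negP => Tn; apply: (H (T 1 s)) (Tren 1%N).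
by rewrite Tn andbT; have := Tinc 0%N; rewrite T0.
Qed.

End Regenerative.

(** * The weights common to all backward ranks *)

Section BackwardRanks.
Context {R : realType} (P : probability permN R).
Hypothesis ind : independent_seq P (fun k => backward_rank k.+1).
Hypothesis u1_gt0 : 0 < renewal_prob P 1.
Hypothesis regen : forall j (A : set nat),
  mass P [set s | renews s 1 /\ A (backward_rank j.+1 s)] =
  renewal_prob P 1 * mass P [set s | A (backward_rank j s)].

Let q j i := mass P [set s | backward_rank j s = i].
Let Q j := mass P [set s | (backward_rank j.+1 s < j.+1)%N].
Let H n := \prod_(l < n) Q l.

Let mb j (A : set nat) : measurable [set s | A (backward_rank j s)].
Proof. exact: measurable_backward_rank. Qed.

Let prefix n (B : nat -> set nat) :
  mass P [set s | forall j, (j < n)%N -> B j (backward_rank j.+1 s)] =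
  \prod_(j < n) mass P [set s | B j (backward_rank j.+1 s)].
Proof.
apply: (@independent_prefix _ _ _ P _ _ (fun k => backward_rank k.+1) B n ind) => // i.
exact: (mb i.+1 (B i)).
Qed.

Let rank0 s : backward_rank 0 s = 0%N.
Proof. by apply/eqP; rewrite -leqn0 backward_rank_le. Qed.

Let q00 : q 0 0 = 1.
Proof.
rewrite /q -(mass_setT P); congr mass; apply/seteqP; split=> // s _ /=; exact: rank0.
Qed.

Let HE n : H n = mass P [set s | forall l, (l < n)%N -> (backward_rank l.+1 s < l.+1)%N].
Proof. by rewrite (prefix n (fun l => [set i | (i < l.+1)%N])). Qed.

(** By [renews1P], a renewal at 1 is the decreasing limit of the events of mass H n. *)
Let cvgH : H n @[n --> \oo] --> renewal_prob P 1.
Proof.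
pose F n := [set s : permN | forall l, (l < n)%N -> (backward_rank l.+1 s < l.+1)%N].
have -> : renewal_prob P 1 = mass P (\bigcap_n F n).
  congr mass; apply/seteqP; split=> s /=.
    by move/renews1P => Hs n _ l _; exact: Hs.
  by move=> Hs; apply/renews1P => l; exact: (Hs l.+1 I l (ltnSn l)).
under eq_fun do rewrite HE.
apply: mass_cvg_down => [n|m n mn].
  rewrite (_ : F n = \bigcap_(l in `I_n) [set s | (backward_rank l.+1 s < l.+1)%N])//.
  apply: fin_bigcap_measurable; first exact: finite_II.
  by move=> l _; exact: (mb l.+1 [set i | (i < l.+1)%N]).
by apply/subsetPset => s Fs l lm; apply: Fs; apply: leq_trans mn.
Qed.

Let H_ge n : renewal_prob P 1 <= H n.
Proof.
rewrite HE; apply: mass_le; first exact: measurable_renews.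
  rewrite (_ : [set s | _] =
    \bigcap_(l in `I_n) [set s | (backward_rank l.+1 s < l.+1)%N])//.
  apply: fin_bigcap_measurable; first exact: finite_II.
  by move=> l _; exact: (mb l.+1 [set i | (i < l.+1)%N]).
by move=> s /renews1P Hs l _; exact: Hs.
Qed.

Let H_gt0 n : 0 < H n. Proof. exact: lt_le_trans (H_ge n). Qed.

Let H_S n : H n.+1 = H n * Q n. Proof. by rewrite /H big_ord_recr. Qed.

Let Q_gt0 n : 0 < Q n.
Proof. by have := H_gt0 n.+1; rewrite H_S pmulr_rgt0. Qed.

(** By independence, prescribing rank j + 1 replaces the factor Q j of H n by [q j.+1 i]. In the
    limit in n this is the mass of a renewal at 1 with that rank, which [regen] evaluates as u_1
    times [q j i]. *)
Let q_succ j i : (i <= j)%N -> q j.+1 i = Q j * q j i.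
Proof.
move=> ij; have u0 : renewal_prob P 1 != 0 by rewrite gt_eqF.
apply: (mulfI u0).
pose E n := [set s : permN | forall l, (l < n)%N -> (backward_rank l.+1 s < l.+1)%N /\
  (l = j -> backward_rank l.+1 s = i)].
have EE n : (j < n)%N -> mass P (E n) * Q j = H n * q j.+1 i.
  move=> jn; rewrite /E.
  rewrite (prefix n (fun l => [set a | (a < l.+1)%N /\ (l = j -> a = i)])).
  rewrite /H (bigD1 (Ordinal jn))//= [in RHS](bigD1 (Ordinal jn))//=.
  rewrite (_ : [set s | _] = [set s | backward_rank j.+1 s = i]); last first.
    apply/seteqP; split=> s /=; first by move=> [_]; apply.
    by move=> ->; split=> //; rewrite ltnS.
  rewrite -/(q _ _) [RHS]mulrC -mulrA; congr (_ * _); rewrite mulrC; congr (_ * _).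
  apply: eq_bigr => l /eqP lj; congr mass; apply/seteqP; split=> s /=; first by case.
  by move=> h; split=> // lj'; case: lj; exact: val_inj.
have cvgE : mass P (E n) @[n --> \oo] --> renewal_prob P 1 * q j i.
  rewrite /q -(regen j [set i]).
  rewrite (_ : [set s | _ /\ _] = \bigcap_n E n); last first.
    apply/seteqP; split=> s /=.
      by move=> [/renews1P Hs e] n _ l _; split=> // ->.
    move=> Hs; split.
      by apply/renews1P => l; exact: (Hs l.+1 I l (ltnSn l)).1.
    exact: (Hs j.+1 I j (ltnSn j)).2 erefl.
  apply: mass_cvg_down => [n|m n mn].
    rewrite (_ : E n = \bigcap_(l in `I_n) [set s |
      [set a | (a < l.+1)%N /\ (l = j -> a = i)] (backward_rank l.+1 s)])//.
    apply: fin_bigcap_measurable; first exact: finite_II.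
    by move=> l _; exact: mb.
  by apply/subsetPset => s Es l lm; apply: Es; apply: leq_trans mn.
have c1 : mass P (E n) * Q j @[n --> \oo] --> (renewal_prob P 1 * q j i) * Q j.
  by apply: cvgM => //; exact: cvg_cst.
have c2 : mass P (E n) * Q j @[n --> \oo] --> renewal_prob P 1 * q j.+1 i.
  apply: cvg_trans (_ : H n * q j.+1 i @[n --> \oo] --> _); last first.
    by apply: cvgM => //; exact: cvg_cst.
  apply: near_eq_cvg; exists j.+1 => // n /= jn; exact/esym/EE.
transitivity (renewal_prob P 1 * q j i * Q j); last by rewrite -mulrA (mulrC (q j i)).
by rewrite -(cvg_lim _ c2)// (cvg_lim _ c1).
Qed.

(** Iterating [q_succ] gives q j i = H j (q i i / H i) for i <= j, so q i i / H i are the weights.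
    Their partial sums are 1 / H j, which tends to 1 / u_1; hence the factor u_1. *)
Definition rank_pmf i := renewal_prob P 1 * q i i / H i.
Local Notation pr := rank_pmf.

Let q_diag j : q j.+1 j.+1 = 1 - Q j.
Proof.
rewrite /Q -mass_setC; last exact: (mb j.+1 [set i | (i < j.+1)%N]).
congr mass; apply/seteqP; split=> s /=; first by move=> ->; rewrite ltnn.
by move=> /negP; rewrite -leqNgt => le; apply/eqP; rewrite eqn_leq le backward_rank_le.
Qed.

(** The sum telescopes, as (1 - Q j) / H (j + 1) = 1 / H (j + 1) - 1 / H j. *)
Lemma rank_pmf_sum j : \sum_(i < j.+1) pr i = renewal_prob P 1 / H j.
Proof.
elim: j => [|j IHj]; first by rewrite big_ord1 /rank_pmf q00 mulr1.
rewrite big_ord_recr/= IHj /rank_pmf q_diag H_S.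
have Hj := gt_eqF (H_gt0 j); have Qj := gt_eqF (Q_gt0 j).
by field; rewrite Hj Qj.
Qed.

Lemma rank_pmf_sum_gt0 j : 0 < \sum_(i < j.+1) pr i.
Proof. by rewrite rank_pmf_sum divr_gt0. Qed.

Lemma rank_pmf_gt0 i : 0 < mass P [set s | backward_rank i s = i] -> 0 < pr i.
Proof. by move=> qi; rewrite /rank_pmf divr_gt0// mulr_gt0. Qed.

Lemma rank_pmf_sum_cvg : \sum_(i < n) pr i @[n --> \oo] --> (1 : R).
Proof.
rewrite -(@cvg_shiftS _ (fun n => \sum_(i < n) pr i : R)).
under eq_fun do rewrite rank_pmf_sum.
have u1 : renewal_prob P 1 / renewal_prob P 1 = 1 by rewrite mulfV// gt_eqF.
rewrite -u1.
apply: cvgM; first exact: cvg_cst.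
by apply: cvgV; rewrite ?gt_eqF.
Qed.

Lemma rank_lawE j i : (i <= j)%N -> q j i = pr i / \sum_(l < j.+1) pr l.
Proof.
move=> ij; rewrite rank_pmf_sum /rank_pmf.
have u0 := gt_eqF u1_gt0.
elim: j ij => [|j IHj].
  rewrite leqn0 => /eqP ->; have := gt_eqF (H_gt0 0) => H0.
  by field; rewrite u0 H0.
rewrite leq_eqVlt => /predU1P[->|].
  by have := gt_eqF (H_gt0 j.+1) => H0; field; rewrite u0 H0.
rewrite ltnS => ij; rewrite q_succ// IHj// H_S.
have Hj := gt_eqF (H_gt0 j); have Qj := gt_eqF (Q_gt0 j); have Hi := gt_eqF (H_gt0 i).
by field; rewrite Hj Qj Hi u0.
Qed.

Lemma mass_proj_perm n (t : 'S_n) : mass P (proj_perm n @^-1` [set t]) =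
  (\prod_(k < n) pr (code (ext t) k)) / \prod_(j < n) \sum_(l < j.+1) pr l.
Proof.
rewrite prod_code_backward_rank -prodf_div.
rewrite (_ : _ @^-1` _ = [set s | forall j, (j < n.-1)%N ->
    [set backward_rank j.+1 (ext t)] (backward_rank j.+1 s)]); last first.
  apply/seteqP; split=> s /=.
    by move=> /proj_perm_eq e j jn; apply: e; lia.
  by move=> e; apply/proj_perm_eq => -[|j] jn; [rewrite !rank0|apply: e; lia].
rewrite (prefix n.-1 (fun j => [set backward_rank j.+1 (ext t)])).
case: n t => [|n] t; first by rewrite !big_ord0.
rewrite [RHS]big_ord_recl/= -rank_lawE ?backward_rank_le// rank0 q00 mul1r.
by apply: eq_bigr => j _; rewrite -rank_lawE ?backward_rank_le.
Qed.

End BackwardRanks.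

(** * From the law of the projections to the law of the codes *)

Section CodeLawOfProj.
Context {R : realType} (P : probability permN R) (pr : nat -> R).
Local Notation F n := (\sum_(i < n) pr i).
Hypothesis F_neq0 : forall n, F n.+1 != 0.
Hypothesis F_cvg : F n @[n --> \oo] --> (1 : R).
Hypothesis proj_law : forall n (t : 'S_n), mass P (proj_perm n @^-1` [set t]) =
  (\prod_(k < n) pr (code (ext t) k)) / \prod_(j < n) F j.+1.

Let proj_code n m (a : nat -> nat) :=
  [set s | forall k, (k < m)%N -> code (ext (proj_perm n s)) k = a k].

Let measurable_proj_code n m a : measurable (proj_code n m a).
Proof.
rewrite (_ : proj_code n m a = \bigcup_(t in [set t : 'S_n |
    forall k, (k < m)%N -> code (ext t) k = a k]) (proj_perm n @^-1` [set t])).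
  apply: fin_bigcup_measurable; first exact: finite_finset.
  by move=> t _; exact: measurable_proj_perm.
apply/seteqP; split=> s /=; first by move=> H; exists (proj_perm n s).
by move=> [t Ht /= e] k km; rewrite e Ht.
Qed.

(** Projecting to m + N letters makes the prescribed codes admissible. The codes from m on are free,
    and their sums cancel against the normalisation. *)
Let mass_proj_code m N (a : nat -> nat) : (forall k, (k < m)%N -> (a k < N)%N) ->
  mass P (proj_code (m + N) m a) = \prod_(k < m) (pr (a k) / F (m + N - k)).
Proof.
move=> aN; set n := (m + N)%N.
pose g k i := if (k < m)%N then if i == a k then pr i else 0 else pr i.
pose E (t : 'S_n) := [set s | proj_perm n s = t /\
  forall k, (k < m)%N -> code (ext t) k = a k].
rewrite (@mass_sum _ _ _ P _ _ E); last 3 first.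
- move=> t; have [Ht|nHt] := pselect (forall k, (k < m)%N -> code (ext t) k = a k).
    rewrite (_ : E t = proj_perm n @^-1` [set t]); first exact: measurable_proj_perm.
    by apply/seteqP; split=> s => [[]|].
  by rewrite (_ : E t = set0)//; apply/seteqP; split=> // s [_ /nHt].
- by move=> t t' s [<- _] [<- _].
- apply/seteqP; split=> s; first by move=> Hs; exists (proj_perm n s).
  by move=> [t _ [e Ht]]; rewrite /proj_code /= e.
transitivity (\sum_(t : 'S_n) (\prod_(k < n) g k (code (ext t) k)) /
    \prod_(j < n) F j.+1).
  apply: eq_bigr => t _.
  have [Ht|nHt] := pselect (forall k, (k < m)%N -> code (ext t) k = a k).
    rewrite (_ : E t = proj_perm n @^-1` [set t]); last first.
      by apply/seteqP; split=> s => [[]|].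
    rewrite proj_law; congr (_ / _); apply: eq_bigr => k _; rewrite /g.
    by case: ifPn => // km; rewrite Ht ?eqxx.
  rewrite (_ : E t = set0); last by apply/seteqP; split=> // s [_ /nHt].
  have [k km nk] : exists2 k, (k < m)%N & code (ext t) k != a k.
    apply: contra_notP nHt => nk k km; apply: contra_notP nk => /eqP nk.
    by exists k.
  have kn : (k < n)%N by rewrite /n ltn_addr.
  by rewrite mass_set0 (bigD1 (Ordinal kn))//= /g km (negbTE nk) !mul0r.
rewrite -mulr_suml sum_prod_code.
have -> : \prod_(j < n) F j.+1 = \prod_(k < n) F (n - k).
  rewrite (reindex_inj rev_ord_inj)/=; apply: eq_bigr => k _.
  by rewrite subnSK.
rewrite -prodf_div /n big_split_ord/= [X in _ * X]big1 ?mulr1.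
  apply: eq_bigr => k _; congr (_ / _).
  have akn : (a k < m + N - k)%N by have := aN k (ltn_ord k); have := ltn_ord k; lia.
  rewrite (bigD1 (Ordinal akn))//= /g ltn_ord eqxx big1 ?addr0// => i.
  by move=> /eqP ik; case: eqP => // e; case: ik; exact: val_inj.
move=> k _; rewrite subnDl /g ltnNge leq_addr/=.
have kN : (N - k = (N - k).-1.+1)%N by have := ltn_ord k; lia.
by rewrite kN mulfV// F_neq0.
Qed.

(** When the first m letters are below n, the first m codes of [s] are those of its projection to
    ['S_n]. This has probability tending to 1, and so do the normalising sums in
    [mass_proj_code]. *)
Lemma code_law_of_proj : code_law P pr.
Proof.
move=> m a; set A := [set s : permN | _].
have mA : measurable A.
  by apply: (@measurable_local m) => s s' e As k km; rewrite -(eq_code e km) As.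
pose N0 := (\max_(k < m) a k).+1.
have aN N k : (k < m)%N -> (a k < N0 + N)%N.
  move=> km; rewrite /N0 addSn ltnS; apply: leq_trans (leq_addr _ _).
  exact: (leq_bigmax (F := fun k : 'I_m => a k) (Ordinal km)).
pose n N := (m + (N0 + N))%N.
pose D N := [set s : permN | forall i, (i < m)%N -> (s i < n N)%N].
have mD N : measurable (D N).
  by apply: (@measurable_local m) => s s' e Ds i im; rewrite -e// Ds.
have cvg_massD : mass P (D N) @[N --> \oo] --> (1 : R).
  apply: mass_cvg_up => // [N N' NN'|].
    apply/subsetPset => s Ds i im; apply: leq_trans (Ds i im) _.
    by rewrite /n !leq_add2l.
  apply/seteqP; split=> // s _; exists (\max_(i < m) s i).+1 => // i im.
  rewrite /n; apply: (@leq_ltn_trans (\max_(i < m) s i)); last by lia.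
  exact: (leq_bigmax (F := fun i : 'I_m => s i) (Ordinal im)).
have ED N : proj_code (n N) m a `&` D N = A `&` D N.
  have e s : D N s -> forall k, (k < m)%N ->
      code (ext (proj_perm (n N) s)) k = code s k.
    by move=> Ds; apply: eq_code => i im; exact: (proj_perm_prefix Ds).
  by apply/seteqP; split=> s [Es Ds]; split=> // k km;
    [rewrite -(e s Ds k km)|rewrite (e s Ds k km)]; exact: Es.
have close N : `|mass P (proj_code (n N) m a) - mass P A| <= 1 - mass P (D N).
  rewrite (massIC P (measurable_proj_code (n N) m a) (mD N)) ED.
  rewrite (massIC P mA (mD N)) opprD addrACA subrr add0r -mass_setC//.
  have mDC : measurable (~` D N) by exact: measurableC.
  have le C : measurable C -> mass P (C `&` ~` D N) <= mass P (~` D N).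
    by move=> mC; apply: mass_le => //; exact: measurableI.
  have := le _ mA; have := le _ (measurable_proj_code (n N) m a).
  have := mass_ge0 P (A `&` ~` D N).
  have := mass_ge0 P (proj_code (n N) m a `&` ~` D N).
  by move=> *; rewrite ler_norml; apply/andP; split; lra.
have c1 : mass P (proj_code (n N) m a) @[N --> \oo] --> mass P A.
  have c0 : 1 - mass P (D N) @[N --> \oo] --> (0 : R).
    by rewrite -(subrr 1); apply: cvgB => //; exact: cvg_cst.
  have c : mass P (proj_code (n N) m a) - mass P A @[N --> \oo] --> (0 : R).
    apply: (@squeeze_cvgr _ _ _ _ (fun N => - (1 - mass P (D N)))
      (fun N => 1 - mass P (D N))) => //.
      by apply: nearW => N; rewrite -ler_norml.
    by rewrite -oppr0; exact: cvgN.
  have h : (mass P (proj_code (n N) m a) - mass P A) + mass P A @[N --> \oo] -->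
      0 + mass P A.
    by apply: cvgD => //; exact: cvg_cst.
  by move: h; rewrite add0r; under eq_fun do rewrite subrK.
have c2 : mass P (proj_code (n N) m a) @[N --> \oo] --> \prod_(k < m) pr (a k).
  under eq_fun do rewrite (mass_proj_code (aN _)).
  have cF k : (k < m)%N -> pr (a k) / F (n N - k) @[N --> \oo] --> pr (a k).
    move=> km; have nE N : (n N - k = N + (m - k + N0))%N by rewrite /n; lia.
    under eq_fun do rewrite nE.
    have c : F (N + (m - k + N0)) @[N --> \oo] --> (1 : R).
      by have := F_cvg; rewrite -(cvg_shiftn (m - k + N0)%N).
    have h : pr (a k) / F (N + (m - k + N0)) @[N --> \oo] --> pr (a k) / 1.
      by apply: cvgM; [exact: cvg_cst|apply: cvgV => //; exact: oner_neq0].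
    by move: h; rewrite divr1.
  have : forall M, (M <= m)%N -> \prod_(k < M) (pr (a k) / F (n N - k)) @[N --> \oo] -->
      \prod_(k < M) pr (a k).
    elim=> [_|M IHM Mm].
      by under eq_fun do rewrite big_ord0; rewrite big_ord0; exact: cvg_cst.
    under eq_fun do rewrite big_ord_recr/=; rewrite big_ord_recr/=.
    by apply: cvgM; [apply: IHM; exact: ltnW|exact: cF].
  exact.
by rewrite -(cvg_lim _ c1)// (cvg_lim _ c2).
Qed.

End CodeLawOfProj.

(** * Finite mean from positive recurrence *)

Lemma renewal_prob_bounded_below (R : realType) (P : probability permN R) (pr : nat -> R)
    (K : R) : code_law P pr -> (forall i, 0 <= pr i) ->
  (forall n, \sum_(i < n) pr i <= 1) ->
  (forall n, \sum_(j < n) no_renewal_prob P j <= K) ->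
  exists2 U : R, 0 < U & forall m, U <= renewal_prob P m.
Proof.
move=> Hc pr0 F1 HK.
have u_dec m n : (m <= n)%N -> renewal_prob P n <= renewal_prob P m.
  move=> mn; rewrite !(renewal_prob_prod Hc) -(subnKC mn) big_split_ord/=.
  rewrite -[leRHS]mulr1; apply: ler_wpM2l.
    by apply: prodr_ge0 => j _; apply: sumr_ge0 => i _.
  by apply: prodr_ile1 => j _; rewrite F1 andbT; apply: sumr_ge0 => i _.
have u_ge0 m : 0 <= renewal_prob P m by exact: mass_ge0.
have u_le1 m : renewal_prob P m <= 1 by rewrite -(renewal_prob0 Hc); exact: u_dec.
pose s n := \sum_(j < n) no_renewal_prob P j.
have g0 j : 0 <= no_renewal_prob P j by exact: mass_ge0.
have s_inc n k : s (n + k)%N = s n + \sum_(j < k) no_renewal_prob P (n + j).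
  by rewrite /s big_split_ord.
have sup_s : has_sup (range s).
  by split; [exists (s 0), 0%N|exists K => _ [n _ <-]; exact: HK].
have e0 : 0 < (4%:R^-1 : R) by rewrite invr_gt0 ltr0n.
(* Beyond n0 the probabilities P(T_1 > j) add up to at most 1/4. *)
have [_ [n0 _ <-] sn0] := sup_adherent e0 sup_s.
have tail k : \sum_(j < k) no_renewal_prob P (n0 + j) <= 4%:R^-1.
  have : s (n0 + k)%N <= sup (range s).
    by apply: ub_le_sup; [case: sup_s|exists (n0 + k)%N].
  by rewrite s_inc; move: sn0; lra.
have K1 : 0 < `|K| + 1 by rewrite ltr_wpDl.
(* From 3/4 <= u_m s(n0) and s(n0) <= K; the divisor |K| + 1 is positive whatever K is. *)
exists (3%:R / 4%:R / (`|K| + 1)); first by rewrite !divr_gt0 ?ltr0n.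
move=> m; rewrite ler_pdivrMr//.
have uK : renewal_prob P m * s n0 <= renewal_prob P m * (`|K| + 1).
  apply: ler_wpM2l => //; apply: le_trans (HK n0) _.
  by apply: le_trans (ler_norm K) _; rewrite lerDl.
apply: le_trans uK.
(* After reversal the index is the length without renewal. Lengths below n0 go with u_j for j > m,
   which is at most u_m; for the other lengths u_j <= 1 and the tail bound apply. *)
have := renewal_identity Hc (n0 + m).
rewrite (reindex_inj rev_ord_inj)/= -addnS big_split_ord/= => e.
have e1 : \sum_(i < n0) renewal_prob P (n0 + m.+1 - i.+1) *
    no_renewal_prob P (n0 + m - (n0 + m.+1 - i.+1)) <= renewal_prob P m * s n0.
  rewrite /s big_distrr/=; apply: ler_sum => i _; have := ltn_ord i => i0.
  rewrite (_ : n0 + m - _ = i)%N; last by lia.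
  by apply: ler_wpM2r => //; apply: u_dec; lia.
have e2 : \sum_(i < m.+1) renewal_prob P (n0 + m.+1 - (n0 + i).+1) *
    no_renewal_prob P (n0 + m - (n0 + m.+1 - (n0 + i).+1)) <= 4%:R^-1.
  apply: le_trans (tail m.+1); apply: ler_sum => i _; have := ltn_ord i => im.
  rewrite (_ : n0 + m - _ = n0 + i)%N; last by lia.
  by rewrite -[leRHS]mul1r; apply: ler_wpM2r.
lra.
Qed.

Lemma conditions_shifted_law (R : realType) (P : probability permN R)
    (T : nat -> {RV P >-> nat}) :
  independent_seq P (fun k => backward_rank k.+1) ->
  strictly_regenerative P T -> positive_recurrent P T ->
  (0 < P [set s : permN | renews s 1])%E ->
  (forall n : nat, (0 < n)%N -> proj_support P n = setT) ->
  exists p : probability nat R,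
     [/\ forall j : nat, (0 < p [set j])%E,
         (\sum_(0 <= n <oo) (n.+1%:R)%:E * p [set n] < +oo)%E
       & shifted_law p P].
Proof.
move=> ind SR PR u1 supp.
have u1_gt0 : 0 < renewal_prob P 1.
  by rewrite -lte_fin /renewal_prob -massE//; exact: measurable_renews.
have regen := mass_renews1_backward_rank SR.
pose pr := rank_pmf P.
have pr_gt0 i : 0 < pr i.
  apply: rank_pmf_gt0 => //.
  (* The support condition is used through one permutation t in which the letter i has maximal
     rank. *)
  have [t ti] := exists_backward_rank (leqnn i).
  have : proj_support P i.+1 t by rewrite supp.
  rewrite /proj_support/= massE; last exact: measurable_proj_perm.
  rewrite lte_fin => /lt_le_trans; apply; apply: mass_le.
  - exact: measurable_proj_perm.
  - exact: (measurable_backward_rank i [set i]).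
  - by move=> s /= /proj_perm_eq -> //.
have Hc : code_law P pr.
  apply: code_law_of_proj.
  - by move=> n; rewrite gt_eqF// rank_pmf_sum_gt0.
  - exact: rank_pmf_sum_cvg.
  - exact: mass_proj_perm.
pose p : probability nat R := distribution P (code_at 0).
have pE i : mass p [set i] = pr i.
  transitivity (mass P (code_at 0 @^-1` [set i])) => //.
  have := Hc 1 (fun=> i); rewrite big_ord1 => <-; congr mass.
  apply/seteqP; split=> s /=; last exact.
  by move=> e [|//].
have pr_ge0 i : 0 <= pr i by exact: ltW.
have F1 n : \sum_(i < n) pr i <= 1.
  by under eq_bigr do rewrite -pE; rewrite -mass_prefix mass_le1.
exists p; split.
- by move=> j; rewrite massE// lte_fin pE.
- have mT A : measurable ((T 1 : permN -> nat) @^-1` A) by exact: measurable_RV.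
  move: PR; rewrite /positive_recurrent (expectation_nat_tail P mT).
  set E := (\sum_(n <oo) _)%E => Elty.
  have Efin : E \is a fin_num by rewrite ge0_fin_numE//; apply: nneseries_ge0.
  have HK n : \sum_(j < n) no_renewal_prob P j <= fine E.
    rewrite -lee_fin fineK// -sumEFin.
    rewrite (eq_bigr (fun k : 'I_n => P ((T 1 : permN -> nat) @^-1`
        [set i | (k < i)%N]))); last first.
      move=> k _; rewrite -(mass_time1_gt SR) -massE//.
      exact: (mT [set i | (k < i)%N]).
    rewrite -(big_mkord predT (fun k => P ((T 1 : permN -> nat) @^-1`
      [set i | (k < i)%N]))).
    exact: nneseries_lim_ge.
  have [U U0 HU] := renewal_prob_bounded_below Hc pr_ge0 F1 HK.
  apply: (@le_lt_trans _ _ (1 + U^-1)%:E); last exact: ltry.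
  apply: lime_le.
    by apply: is_cvg_nneseries => n _ _; rewrite mule_ge0.
  apply: nearW => n; rewrite big_mkord.
  rewrite (eq_bigr (fun k : 'I_n => (k.+1%:R * pr k)%:E)).
    rewrite sumEFin lee_fin; apply: (sum_tail_of_prod_le pr_ge0 F1 U0).
    by move=> m; rewrite -(renewal_prob_prod Hc).
  by move=> k _; rewrite massE// pE EFinM.
- exact: code_law_shifted_law Hc.
Qed.

Local Open Scope ereal_scope.

Theorem proposition3 (R : realType) (P : probability permN R) :
  (exists p : probability nat R,
     [/\ forall j : nat, 0 < p [set j],
         \sum_(0 <= n <oo) (n.+1%:R%R)%:E * p [set n] < +oo
       & shifted_law p P])
  <->
  [/\ independent_seq P (fun k => backward_rank k.+1),
      (exists T : nat -> {RV P >-> nat},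
         strictly_regenerative P T /\ positive_recurrent P T) /\
      0 < P [set s : permN | renews s 1]
    & forall n : nat, (0 < n)%N -> proj_support P n = setT].
Proof.
split; first by move=> [p [p0 Sp sh]]; exact: shifted_law_conditions p0 Sp sh.
by move=> [ind [[T [SR PR]] u1] supp]; exact: conditions_shifted_law ind SR PR u1 supp.
Qed.
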